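(* Let $\mathcal{H}_A,\mathcal{H}_B$ be finite-dimensional Hilbert spaces of dimensions $d_A,d_B$, let $U\in\mathsf{U}(\mathcal{H}_A\otimes\mathcal{H}_B)$, let $\mathcal{U}(\rho)=U\rho U^\dagger$, and let $U=\sum_{j=1}^m c_j V_j\otimes W_j$ with $c\in\mathbb{R}^m$, $V_j\in\mathsf{U}(\mathcal{H}_A)$, $W_j\in\mathsf{U}(\mathcal{H}_B)$. Set $\phi:=2\|c\|_1^2-\|c\|_2^2$. Then the double Hadamard test associated with this decomposition (described in the context) is a local space-like cut of $\mathcal{U}$ with two ancilla qubits ($d_{R_A}=d_{R_B}=2$) and 1-norm $\phi$; that is, $$\mathcal{U}=\sum_{i,j}c_ic_j\,(\mathrm{id}_{AB}\otimes\mathcal{T})\circ(\mathcal{V}^{(i,j,0)}\otimes\mathcal{W}^{(i,j,0)})-\sum_{i\neq j}c_ic_j\,(\mathrm{id}_{AB}\otimes\mathcal{T})\circ(\mathcal{V}^{(i,j,1)}\otimes\mathcal{W}^{(i,j,1)}),$$ a decomposition whose coefficient vector has 1-norm $\phi$. Moreover, if the decomposition $U=\sum_j c_jV_j\otimes W_j$ is an operator Schmidt decomposition, then $$\phi=\xi(U)=\gamma(\mathcal{U})=2\|c\|_1^2-1.$$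
   Context: Sign convention: replacing $V_j$ by $\mathrm{sign}(c_j)V_j$ and $c_j$ by $|c_j|$ (and dropping zero terms), we may regard all $c_j>0$; $\phi$ depends only on $|c|$. Double Hadamard test: for $(i,j,g)\in[m]^2\times\{0,1\}$, let $\mathcal{V}^{(i,j,g)}:\mathsf{L}(\mathcal{H}_A)\to\mathsf{L}(\mathcal{H}_A\otimes\mathbb{C}^2_{R_A})$ be the isometric channel that appends an ancilla qubit $R_A$ in $|0\rangle$, applies a Hadamard gate to $R_A$, then (if $g=1$) the phase gate $S=\mathrm{diag}(1,\mathrm{i})$ to $R_A$, then the controlled unitary $|0\rangle\langle0|_{R_A}\otimes V_i+|1\rangle\langle1|_{R_A}\otimes V_j$, then a Hadamard gate on $R_A$. Define $\mathcal{W}^{(i,j,g)}$ on $B$ with ancilla $R_B$ identically with $W_i,W_j$ in place of $V_i,V_j$. Let $\mathcal{T}:\mathsf{L}(\mathbb{C}^2_{R_A}\otimes\mathbb{C}^2_{R_B})\to\mathbb{C}$, $\mathcal{T}(Y)=\mathrm{Tr}((\sigma_z\otimes\sigma_z)Y)$. A space-like cut of a channel $\mathcal{N}_{AB\to AB}$ is a decomposition $\mathcal{N}=\sum_{i=1}^m a_i(\mathrm{id}_{AB}\otimes\mathcal{T}_i)\circ\mathcal{E}_i$ with $a\in\mathbb{R}^m$, channels $\mathcal{E}_i:\mathsf{L}(\mathcal{H}_{AB})\to\mathsf{L}(\mathcal{H}_{AR_ABR_B})$ implementable by LOCC between $A R_A$ and $B R_B$, and $\mathcal{T}_i(Y)=\mathrm{Tr}(O_iY)$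 with $O_i=O_i^{(A)}\otimes O_i^{(B)}$, $O_i^{(A)}\in\mathsf{L}(\mathcal{H}_{R_A})$, $O_i^{(B)}\in\mathsf{L}(\mathcal{H}_{R_B})$, $\|O_i\|\le1$. Its 1-norm is $\|a\|_1$; $\gamma(\mathcal{N})$ is the infimum of the 1-norm over all space-like cuts. It is local if each $\mathcal{E}_i=\mathcal{V}_i\otimes\mathcal{W}_i$ with $\mathcal{V}_i,\mathcal{W}_i$ isometric channels. The product extent $\xi(U)$ is the minimum of $2\|c\|_1^2-\|c\|_2^2$ over all decompositions $U=\sum_j c_jV_j\otimes W_j$ with $c$ real and $V_j,W_j$ unitary. An operator Schmidt decomposition of $X\in\mathsf{L}(\mathcal{H}_{AB})$ is $X=\sum_j\lambda_jA_j\otimes B_j$ with $\mathrm{Tr}(A_j^\dagger A_k)=d_A\delta_{jk}$, $\mathrm{Tr}(B_j^\dagger B_k)=d_B\delta_{jk}$, $\lambda_j>0$, $\sum_j\lambda_j^2=1$. *)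

(* Defs.v *)
(* Complex numbers are  R[i] = complex R  for  R : realType
   (mathcomp-real-closed), so that real infima ('inf' from mathcomp-reals) are
   available for the quantities gamma and xi.

   Finite-dimensional Hilbert spaces are C^X for a finite index type X
   (H_A = C^'I_dA, H_B = C^'I_dB, H_AB = C^('I_dA * 'I_dB), a qubit = C^'I_2),
   and an operator / linear map C^Y -> C^X is a function  X -> Y -> C
   (its matrix).  Tensor products of spaces are products of index types. *)
From mathcomp Require Import all_boot all_order all_algebra.
From mathcomp Require Import complex reals.
Set Implicit Arguments.
Unset Strict Implicit.
Unset Printing Implicit Defensive.
Import Order.TTheory GRing.Theory Num.Theory.
Local Open Scope ring_scope.
Local Open Scope complex_scope.

Definition mx (R : realType) (X Y : finType) := X -> Y -> R[i].
Arguments mx R X%_type Y%_type.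

Definition mxmul {R : realType} {X Y Z : finType} (M : mx R X Y) (N : mx R Y Z)
  : mx R X Z := fun x z => \sum_(y : Y) M x y * N y z.

Definition adj {R : realType} {X Y : finType} (M : mx R X Y) : mx R Y X :=
  fun y x => (M x y)^*.

Definition idmx (R : realType) (X : finType) : mx R X X :=
  fun x y => (x == y)%:R.
Arguments idmx R X : clear implicits.

Definition mtrace {R : realType} {X : finType} (M : mx R X X) : R[i] :=
  \sum_(x : X) M x x.

Definition mxtens {R : realType} {X1 Y1 X2 Y2 : finType}
  (M : mx R X1 Y1) (N : mx R X2 Y2) : mx R (X1 * X2) (Y1 * Y2) :=
  fun x y => M x.1 y.1 * N x.2 y.2.

Definition ematrix (R : realType) {X : finType} (x x' : X) : mx R X X :=
  fun y y' => ((y == x) && (y' == x'))%:R.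

Definition unitary {R : realType} {X : finType} (U : mx R X X) : Prop :=
  mxmul (adj U) U = idmx R X /\ mxmul U (adj U) = idmx R X.

Definition isometry {R : realType} {Y X : finType} (V : mx R Y X) : Prop :=
  mxmul (adj V) V = idmx R X.

Definition mxapp {R : realType} {X Y : finType} (M : mx R X Y) (v : Y -> R[i])
  : X -> R[i] := fun x => \sum_(y : Y) M x y * v y.

Definition vnorm2 {R : realType} {X : finType} (v : X -> R[i]) : R[i] :=
  \sum_(x : X) `|v x| ^+ 2.

Definition opnorm_le1 {R : realType} {X Y : finType} (M : mx R X Y) : Prop :=
  forall v : Y -> R[i], vnorm2 (mxapp M v) <= vnorm2 v.

Definition psd {R : realType} {X : finType} (M : mx R X X) : Prop :=
  forall v : X -> R[i], 0 <= \sum_(x : X) \sum_(y : X) (v x)^* * M x y * v y.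

Definition sop (R : realType) (X Y : finType) := mx R X X -> mx R Y Y.
Arguments sop R X%_type Y%_type.

Definition sop_linear {R : realType} {X Y : finType} (F : sop R X Y) : Prop :=
  forall (a : R[i]) (rho sigma : mx R X X),
    F (fun x y => a * rho x y + sigma x y) = fun x y => a * F rho x y + F sigma x y.

Definition ampl {R : realType} {X Y : finType} (F : sop R X Y) (n : nat)
  (P : mx R (X * 'I_n) (X * 'I_n)) : mx R (Y * 'I_n) (Y * 'I_n) :=
  fun p q => F (fun x x' => P (x, p.2) (x', q.2)) p.1 q.1.

Definition cp_map {R : realType} {X Y : finType} (F : sop R X Y) : Prop :=
  sop_linear F /\ forall (n : nat) (P : mx R (X * 'I_n) (X * 'I_n)),
    psd P -> psd (ampl F P).

Definition tp_map {R : realType} {X Y : finType} (F : sop R X Y) : Prop :=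
  forall rho : mx R X X, mtrace (F rho) = mtrace rho.

Definition channel {R : realType} {X Y : finType} (F : sop R X Y) : Prop :=
  cp_map F /\ tp_map F.

Definition instrument {R : realType} {X Y : finType} {K : finType}
  (E : K -> sop R X Y) : Prop :=
  (forall k, cp_map (E k)) /\ tp_map (fun rho x y => \sum_(k : K) E k rho x y).

(* tensor product of (linear) superoperators, defined on matrix units *)
Definition stens {R : realType} {X1 Y1 X2 Y2 : finType}
  (F : sop R X1 Y1) (G : sop R X2 Y2) : sop R (X1 * X2) (Y1 * Y2) :=
  fun rho p q => \sum_(a : X1 * X2) \sum_(b : X1 * X2)
     rho a b * F (ematrix R a.1 b.1) p.1 q.1 * G (ematrix R a.2 b.2) p.2 q.2.

Definition sid (R : realType) (X : finType) : sop R X X := fun rho => rho.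
Arguments sid R X : clear implicits.

Definition iso_conj {R : realType} {Y X : finType} (V : mx R Y X) : sop R X Y :=
  fun rho => mxmul (mxmul V rho) (adj V).

Definition isometric_channel {R : realType} {X Y : finType} (F : sop R X Y) : Prop :=
  exists V : mx R Y X, isometry V /\ F = iso_conj V.

(* ---------- LOCC (finite-round) ----------
   LOCC R XA XB YA YB F : the channel F : L(H_XA (x) H_XB) -> L(H_YA (x) H_YB)
   is implementable by (finitely many rounds of) local operations and
   classical communication between Alice (XA -> YA) and Bob (XB -> YB):
   either a product of local channels, or a local instrument on one side whose
   outcome k is communicated and followed by an LOCC protocol depending on k. *)
Inductive LOCC (R : realType) :
  forall XA XB YA YB : finType, sop R (XA * XB) (YA * YB) -> Prop :=
| LOCC_local (XA XB YA YB : finType) (F : sop R XA YA) (G : sop R XB YB) :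
    channel F -> channel G -> LOCC (stens F G)
| LOCC_Alice (XA XB ZA YA YB : finType) (K : finType)
    (E : K -> sop R XA ZA) (F : K -> sop R (ZA * XB) (YA * YB)) :
    instrument E -> (forall k, LOCC (F k)) ->
    LOCC (fun rho x y => \sum_(k : K) F k (stens (E k) (sid R XB) rho) x y)
| LOCC_Bob (XA XB ZB YA YB : finType) (K : finType)
    (E : K -> sop R XB ZB) (F : K -> sop R (XA * ZB) (YA * YB)) :
    instrument E -> (forall k, LOCC (F k)) ->
    LOCC (fun rho x y => \sum_(k : K) F k (stens (sid R XA) (E k) rho) x y).

(* (id_AB (x) T_O)(Y),  T_O(Z) = Tr(O Z),  for Y in L(H_{A R_A B R_B}) *)
Definition idT {R : realType} {A B RA RB : finType} (O : mx R (RA * RB) (RA * RB))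
  (Y : mx R ((A * RA) * (B * RB)) ((A * RA) * (B * RB))) : mx R (A * B) (A * B) :=
  fun x x' => \sum_(s : RA * RB) \sum_(s' : RA * RB)
    Y ((x.1, s.1), (x.2, s.2)) ((x'.1, s'.1), (x'.2, s'.2)) * O s' s.

Definition norm1 {R : realType} {I : finType} (a : I -> R) : R :=
  \sum_(i : I) `|a i|.

Definition is_space_like_cut {R : realType} {A B : finType} (I : finType)
  (dRA dRB : nat) (a : I -> R)
  (E : I -> sop R (A * B) ((A * 'I_dRA) * (B * 'I_dRB)))
  (OA : I -> mx R 'I_dRA 'I_dRA) (OB : I -> mx R 'I_dRB 'I_dRB)
  (N : sop R (A * B) (A * B)) : Prop :=
  [/\ forall rho, N rho =
        (fun x x' => \sum_(i : I) (a i)%:C * idT (mxtens (OA i) (OB i)) (E i rho) x x'),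
      forall i, LOCC (E i) &
      forall i, opnorm_le1 (mxtens (OA i) (OB i))].

Definition is_local_cut {R : realType} {A B : finType} (I : finType)
  (dRA dRB : nat) (a : I -> R)
  (E : I -> sop R (A * B) ((A * 'I_dRA) * (B * 'I_dRB)))
  (OA : I -> mx R 'I_dRA 'I_dRA) (OB : I -> mx R 'I_dRB 'I_dRB)
  (N : sop R (A * B) (A * B)) : Prop :=
  is_space_like_cut a E OA OB N /\
  forall i, exists (F : sop R A (A * 'I_dRA)) (G : sop R B (B * 'I_dRB)),
    [/\ isometric_channel F, isometric_channel G & E i = stens F G].

Definition gamma {R : realType} {A B : finType} (N : sop R (A * B) (A * B)) : R :=
  inf (fun r : R => exists (m dRA dRB : nat) (a : 'I_m -> R)
        (E : 'I_m -> sop R (A * B) ((A * 'I_dRA) * (B * 'I_dRB)))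
        (OA : 'I_m -> mx R 'I_dRA 'I_dRA) (OB : 'I_m -> mx R 'I_dRB 'I_dRB),
        is_space_like_cut a E OA OB N /\ r = norm1 a).

Definition is_prod_decomp {R : realType} {A B : finType} {I : finType}
  (U : mx R (A * B) (A * B)) (c : I -> R) (V : I -> mx R A A) (W : I -> mx R B B)
  : Prop :=
  U = fun x y => \sum_(j : I) (c j)%:C * mxtens (V j) (W j) x y.

Definition product_extent {R : realType} {A B : finType} (U : mx R (A * B) (A * B))
  : R :=
  inf (fun r : R => exists (m : nat) (c : 'I_m -> R) (V : 'I_m -> mx R A A)
        (W : 'I_m -> mx R B B),
        [/\ forall j, unitary (V j), forall j, unitary (W j),
            is_prod_decomp U c V W &
            r = 2 * norm1 c ^+ 2 - \sum_j c j ^+ 2]).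

Definition is_op_schmidt {R : realType} {A B : finType} {I : finType}
  (X : mx R (A * B) (A * B)) (lam : I -> R) (Aj : I -> mx R A A)
  (Bj : I -> mx R B B) : Prop :=
  [/\ is_prod_decomp X lam Aj Bj,
      forall j k, mtrace (mxmul (adj (Aj j)) (Aj k)) = (#|A| * (j == k))%:R,
      forall j k, mtrace (mxmul (adj (Bj j)) (Bj k)) = (#|B| * (j == k))%:R,
      forall j, 0 < lam j &
      \sum_j lam j ^+ 2 = 1].

Definition qb0 (r : 'I_2) : bool := (nat_of_ord r == 0%N).

Definition hadamard (R : realType) : mx R 'I_2 'I_2 :=
  fun r s => (if ~~ qb0 r && ~~ qb0 s then -1 else 1) * ((Num.sqrt (2%:R : R))^-1)%:C.

Definition phaseS (R : realType) : mx R 'I_2 'I_2 :=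
  fun r s => if r == s then (if qb0 r then 1 else 'i) else 0.

Definition sigmaz (R : realType) : mx R 'I_2 'I_2 :=
  fun r s => if r == s then (if qb0 r then 1 else -1) else 0.

Definition onanc {R : realType} {A : finType} (G : mx R 'I_2 'I_2)
  : mx R (A * 'I_2) (A * 'I_2) := mxtens (idmx R A) G.

Definition append0 (R : realType) (A : finType) : mx R (A * 'I_2) A :=
  fun p a => ((p.1 == a) && qb0 p.2)%:R.
Arguments append0 R A : clear implicits.

Definition ctrlU {R : realType} {A : finType} (V0 V1 : mx R A A)
  : mx R (A * 'I_2) (A * 'I_2) :=
  fun p q => if p.2 == q.2 then (if qb0 q.2 then V0 p.1 q.1 else V1 p.1 q.1) else 0.

Definition dh_iso {R : realType} {A : finType} (Vi Vj : mx R A A) (g : bool)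
  : mx R (A * 'I_2) A :=
  mxmul (onanc (hadamard R))
   (mxmul (ctrlU Vi Vj)
    (mxmul (onanc (if g then phaseS R else idmx R 'I_2))
     (mxmul (onanc (hadamard R)) (append0 R A)))).

Definition dh_channel {R : realType} {A : finType} {m : nat} (V : 'I_m -> mx R A A)
  (i j : 'I_m) (g : bool) : sop R A (A * 'I_2) :=
  iso_conj (dh_iso (V i) (V j) g).

Definition DHidx (m : nat) : finType :=
  {x : 'I_m * 'I_m * bool | x.2 ==> (x.1.1 != x.1.2)}.

Definition dh_coef {R : realType} {m : nat} (c : 'I_m -> R) (x : DHidx m) : R :=
  if (val x).2 then - (c (val x).1.1 * c (val x).1.2)
  else c (val x).1.1 * c (val x).1.2.

Definition dh_E {R : realType} {A B : finType} {m : nat} (V : 'I_m -> mx R A A)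
  (W : 'I_m -> mx R B B) (x : DHidx m) : sop R (A * B) ((A * 'I_2) * (B * 'I_2)) :=
  stens (dh_channel V (val x).1.1 (val x).1.2 (val x).2)
        (dh_channel W (val x).1.1 (val x).1.2 (val x).2).

(* Main.v *)
(* On A with ancilla, the double Hadamard circuit followed by sigma_z on the
   ancilla is (1/2) (s' V_i . V_j' + s V_j . V_i') with s = i^g and ' the adjoint; multiplying
   the A and B parts and summing over i, j and g leaves only the terms
   c_i c_j (V_i (x) W_i) . (V_j (x) W_j)'.

   For the lower bound, apply both sides of a cut to the product of unnormalised
   maximally entangled states and pair with H = 2 |Phi><Phi| - d_A d_B, where
   Phi = \sum_j vec(V_j) (x) vec(W_j).  On the Choi state of U the pairing is
   (d_A d_B)^2 (2 |c|_1^2 - 1).  By Bessel and Cauchy-Schwarz,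
   |<P (x) Q, H>| <= d_A d_B tr P tr Q for positive P, Q.  This survives LOCC.
   It also survives a product observable, because a matrix of norm r is a sum
   \sum_k mu_k |e_k><e_k| with |mu_k| = r and \sum_k |e_k><e_k| = 1, which reduces
   the pairing to compressed positive P and Q even for a non-Hermitian observable.
   Hence each term of the cut is at most (d_A d_B)^2 in modulus. *)
From mathcomp Require Import all_boot all_order all_algebra.
From mathcomp Require Import complex reals boolp spectral ring lra.
Require Import Defs.
Set Implicit Arguments.
Unset Strict Implicit.
Unset Printing Implicit Defensive.
Import Order.TTheory GRing.Theory Num.Theory.
Local Open Scope ring_scope.

(** * Spectral theorem and rank-one decompositions of positive operators *)

Section Spectral.
Variable R : realType.
Local Notation C := R[i].
Local Open Scope sesquilinear_scope.

Lemma normalmx_spectral n (A : 'M[C]_n) : A \is normalmx ->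
  exists (P : 'M[C]_n) (d : 'rV[C]_n),
    [/\ P *m P^t* = 1%:M, P^t* *m P = 1%:M & A = P^t* *m diag_mx d *m P].
Proof.
move=> /orthomx_spectralP eA; exists (spectralmx A), (spectral_diag A).
have U := spectral_unitarymx A.
have e := unitarymxP U.
split=> //; first by apply: mulmx1C.
by rewrite -invmx_unitary.
Qed.

Lemma unitary_diagE n (P : 'M[C]_n) (d : 'rV[C]_n) i j :
  (P^t* *m diag_mx d *m P) i j = \sum_k d 0 k * (P k i)^* * P k j.
Proof.
rewrite mul_mx_diag mxE; apply: eq_bigr => k _.
by rewrite !mxE; congr (_ * _); rewrite mulrC.
Qed.

(** In [R[i]] the relation [0 <= z] includes that [z] is real. Reality of the quadratic form at e_x
    + t e_y, taken at t = 1 and t = i, gives the conjugate symmetry. *)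
Lemma psd_herm (X : finType) (P : mx R X X) : psd P -> forall x y, P y x = (P x y)^*.
Proof.
move=> hP x y.
have key (t : C) : 0 <= P x x + t * P x y + t^* * P y x + t * t^* * P y y.
  have := hP (fun z => (z == x)%:R + t * (z == y)%:R).
  have S1 (F : X -> C) (s : C) : \sum_z ((z == x)%:R + s * (z == y)%:R) * F z = F x + s * F y.
    under eq_bigr do rewrite mulrDl -mulrA.
    rewrite big_split /= -mulr_sumr.
    have D (z : X) : \sum_w (w == z)%:R * F w = F z.
      by rewrite (bigD1 z) //= eqxx mul1r big1 ?addr0 // => i /negPf ->; rewrite mul0r.
    by rewrite !D.
  have -> : \sum_z \sum_w ((z == x)%:R + t * (z == y)%:R)^* * P z w * ((w == x)%:R + t * (w == y)%:R)
    = \sum_z ((z == x)%:R + t^* * (z == y)%:R) * (P z x + t * P z y).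
    apply: eq_bigr => z _.
    rewrite rmorphD rmorphM /= !conjC_nat -S1 mulr_sumr; apply: eq_bigr => w _; ring.
  rewrite S1 => h; congr (0 <= _): h; ring.
have h0 := key 0; have h1 := key 1; have hi := key 'i%C.
rewrite !(conjC0, mul0r, addr0) in h0.
have hy : 0 <= P y y.
  have := hP (fun z => (z == y)%:R).
  rewrite (bigD1 y) //= (bigD1 y) //= !big1 ?eqxx ?addr0 ?conjC1 ?mulr1 ?mul1r //.
    by move=> i /negPf ->; rewrite big1 // => j _; rewrite conjC0 !mul0r.
  by move=> i /negPf ->; rewrite mulr0.
move: h0 h1 hi hy; rewrite !lecE.
case: (P x x) (P x y) (P y x) (P y y) => [a a'] [b b'] [c c'] [d d'].
simpc => /=.
move=> /andP[/eqP h0 _] /andP[/eqP h1 _] /andP[/eqP h2 _] /andP[/eqP h3 _].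
by apply/eqP; rewrite eq_complex /=; apply/andP; split; apply/eqP; lra.
Qed.

(** The eigenvalues are values of the form at the eigenvectors, hence nonnegative, and their square
    roots are absorbed into the eigenvectors. *)
Lemma psd_rank1 (X : finType) (P : mx R X X) : psd P ->
  exists v : 'I_#|X| -> X -> C, forall x y, P x y = \sum_k v k x * (v k y)^*.
Proof.
move=> hP.
pose A : 'M[C]_#|X| := \matrix_(i, j) P (enum_val i) (enum_val j).
have Ah : A^t* = A.
  by apply/matrixP=> i j; rewrite !mxE [in RHS](psd_herm hP).
have /normalmx_spectral [Q [d [QQ QQ' eA]]] : A \is normalmx.
  by apply/normalmxP; rewrite Ah.
have d_ge0 k : 0 <= d 0 k.
  have -> : d 0 k = (Q *m A *m Q^t*) k k.
    by rewrite eA !mulmxA QQ mul1mx -mulmxA QQ mulmx1 mxE eqxx.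
  have := hP (fun x => (Q k (enum_rank x))^*).
  congr (0 <= _); rewrite (reindex _ (onW_bij _ (enum_val_bij X))) /= mulmxE.
  rewrite mxE exchange_big /= (reindex _ (onW_bij _ (enum_val_bij X))) /=.
  apply: eq_bigr => i _; rewrite !mxE mulr_suml; apply: eq_bigr => j _.
  by rewrite !mxE !enum_valK conjCK.
exists (fun k x => sqrtC (d 0 k) * (Q k (enum_rank x))^*) => x y.
have -> : P x y = A (enum_rank x) (enum_rank y) by rewrite mxE !enum_rankK.
rewrite {1}eA unitary_diagE; apply: eq_bigr => k _.
rewrite rmorphM /= conjCK.
have -> : (sqrtC (d 0 k))^* = sqrtC (d 0 k).
  by apply: conj_Creal; rewrite ger0_real // sqrtC_ge0.
by rewrite -{1}[d 0 k]sqrtCK; ring.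
Qed.

End Spectral.

(** * Operators as rank-one sums with coefficients of constant modulus *)

Section Contraction.
Variable R : realType.
Local Notation C := R[i].
Local Open Scope sesquilinear_scope.

Lemma real_complex_is_real (x : R) : (x%:C%C : C) \is Num.real.
Proof. by apply/complex_realP; exists x. Qed.

Lemma adjmx_mul m n p (A : 'M[C]_(m, n)) (B : 'M[C]_(n, p)) :
  (A *m B)^t* = B^t* *m A^t*.
Proof. by rewrite trmx_mul map_mxM. Qed.

(** The two hypotheses make [T] normal; in an eigenbasis the first one reads |t_k|^2 = r^2. *)
Lemma scaled_unitary_spectral n (T : 'M[C]_n) (r : C) : 0 <= r ->
  T *m T^t* = (r ^+ 2)%:M -> T^t* *m T = (r ^+ 2)%:M ->
  exists (Q : 'M[C]_n) (t : 'rV[C]_n),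
    [/\ Q^t* *m Q = 1%:M, T = Q^t* *m diag_mx t *m Q & forall k, `|t 0 k| = r].
Proof.
move=> r0 h1 h2.
have /normalmx_spectral [Q [t [QQ QQ' eT]]] : T \is normalmx.
  by apply/normalmxP; rewrite h1 h2.
exists Q, t; split=> // k; apply/eqP; rewrite -(eqrXn2 (n := 2)) //; apply/eqP.
have : (Q *m (T *m T^t*) *m Q^t*) k k = r ^+ 2.
  by rewrite h1 mul_mx_scalar -scalemxAl QQ !mxE eqxx mulr1.
have -> : Q *m (T *m T^t*) *m Q^t* = diag_mx t *m (diag_mx t)^t*.
  rewrite eT !adjmx_mul trmxCK !mulmxA QQ mul1mx.
  by rewrite -(mulmxA _ Q) QQ mulmx1 -(mulmxA _ Q) QQ mulmx1.
rewrite tr_diag_mx map_diag_mx mul_diag_mx !mxE eqxx mulr1n => <-.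
by rewrite normCK.
Qed.

(* The Hermitian dilation [S] of [O] gives [O] as a corner of the mean of the
   two scaled unitaries [(S +- i sqrt(r^2 - S^2)) X], with [X] the block swap;
   diagonalising them yields the decomposition. *)
Lemma phase_decomposition n (O : mx R 'I_n 'I_n) :
  exists (r : C) (K : finType) (mu : K -> C) (e : K -> 'I_n -> C),
    [/\ 0 <= r, forall k, `|mu k| = r,
        forall i j, O i j = \sum_k mu k * e k i * (e k j)^*,
        forall i j, \sum_k e k i * (e k j)^* = (i == j)%:R &
        r = 0 \/ exists2 b : 'I_n -> C, 0 < vnorm2 b &
                   vnorm2 (mxapp O b) = r ^+ 2 * vnorm2 b].
Proof.
pose M : 'M[C]_n := \matrix_(i, j) O i j.
pose S : 'M[C]_(n + n) := block_mx 0 M (M^t*) 0.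
have Sh : S^t* = S.
  by rewrite /S tr_block_mx map_block_mx trmxCK !trmx0 !map_mx0.
have hS : S \is hermsymmx.
  by apply/is_hermitianmxP; rewrite expr0 scale1r Sh.
have dreal := hermitian_spectral_diag_real hS.
have /hermitian_normalmx/orthomx_spectralP := hS.
have U := spectral_unitarymx S.
rewrite invmx_unitary //.
move: dreal U; move: (spectralmx S) (spectral_diag S) => P d dreal /unitarymxP PP eS.
have PP' := mulmx1C PP.
have dR k : d 0 k \is Num.real by move/mxOverP : dreal; apply.
(* In dimension 0 there is no eigenvalue to maximise over; the empty family with [r = 0] serves. *)
have [n0|n_gt0] := posnP n.
  exists 0, void, (fun=> 0), (fun=> fun=> 0); split=> //; last by left.
  - by move=> i; exfalso; have := ltn_ord i; rewrite {2}n0.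
  - by move=> i; exfalso; have := ltn_ord i; rewrite {2}n0.
have k0 : 'I_(n + n) := lshift n (Ordinal n_gt0).
pose l (k : 'I_(n + n)) : R := complex.Re (d 0 k).
have dl k : d 0 k = (l k)%:C%C by rewrite /l RRe_real.
pose km := [arg max_(k > k0) `|l k|]%O.
have lmax k : `|l k| <= `|l km|.
  by rewrite /km; case: Order.TotalTheory.arg_maxP => // i _; apply.
(* The eigenvalues of the dilation are the singular values of [O] up to sign, so [r] is the operator
   norm of [O]. Maximality keeps r^2 - l_k^2 nonnegative under the square root. *)
pose r := `|l km|%:C%C.
have r0 : 0 <= r by rewrite /r ler0c.
(* Since [l k] is real, both values l_k +- i sqrt(r^2 - l_k^2) have modulus [r], and their mean is
   [l k]. *)
pose g (b : bool) : 'rV[C]_(n + n) :=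
  \row_k (d 0 k + (-1) ^+ b * ('i * (Num.sqrt (l km ^+ 2 - l k ^+ 2))%:C%C)).
have gg b k : g b 0 k * (g b 0 k)^* = r ^+ 2.
  rewrite mxE dl rmorphD !rmorphM rmorph_sign /= conjCi.
  have cR (x : R) : (x%:C%C)^* = x%:C%C.
    by rewrite conj_Creal ?real_complex_is_real.
  rewrite !cR; set w := Num.sqrt _.
  have ww : w%:C%C ^+ 2 = r ^+ 2 - (l k)%:C%C ^+ 2.
    rewrite /r -!rmorphXn -rmorphB /= sqr_sqrtr ?real_normK ?num_real //.
    by rewrite subr_ge0 -ler_sqrt ?sqr_ge0 // !sqrtr_sqr.
  have -> : r ^+ 2 = (l k)%:C%C ^+ 2 + w%:C%C ^+ 2 by rewrite ww; ring.
  have ii : 'i ^+ 2 = -1 :> C := sqrCi C.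
  have ss : ((-1) ^+ b) ^+ 2 = 1 :> C by rewrite sqrr_sign.
  move: ((-1) ^+ b) ss => s ss.
  transitivity ((l k)%:C%C ^+ 2 - s ^+ 2 * 'i ^+ 2 * w%:C%C ^+ 2); first by ring.
  by rewrite ss ii; ring.
pose X : 'M[C]_(n + n) := block_mx 0 1%:M 1%:M 0.
have Xh : X^t* = X.
  by rewrite /X tr_block_mx map_block_mx !trmx0 !trmx1 !map_mx0 !map_mx1.
have XX : X *m X = 1%:M.
  by rewrite /X mulmx_block !(mul0mx, mulmx0, mulmx1, add0r, addr0) -scalar_mx_block.
pose T b := P^t* *m diag_mx (g b) *m P *m X.
have dg b : diag_mx (g b) *m (diag_mx (g b))^t* = (r ^+ 2)%:M.
  rewrite tr_diag_mx map_diag_mx mul_diag_mx; apply/matrixP=> i j; rewrite !mxE.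
  by case: eqP => [->|_]; rewrite ?mulr0 // !mulr1n -(gg b j) !mxE.
have dg' b : (diag_mx (g b))^t* *m diag_mx (g b) = (r ^+ 2)%:M.
  by rewrite -(dg b) tr_diag_mx map_diag_mx diag_mxC.
have T1 b : T b *m (T b)^t* = (r ^+ 2)%:M.
  rewrite /T !adjmx_mul trmxCK Xh !mulmxA -(mulmxA _ X X) XX mulmx1.
  rewrite -(mulmxA _ P (P^t*)) PP mulmx1 -(mulmxA _ (diag_mx _)) dg.
  by rewrite mul_mx_scalar -scalemxAl PP' scale_scalar_mx mulr1.
have T2 b : (T b)^t* *m T b = (r ^+ 2)%:M.
  rewrite /T !adjmx_mul trmxCK Xh !mulmxA -(mulmxA _ P (P^t*)) PP mulmx1.
  rewrite -(mulmxA _ _ (diag_mx (g b))) dg'.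
  by rewrite mul_mx_scalar -!scalemxAl -(mulmxA _ _ P) PP' mulmx1 XX scale_scalar_mx mulr1.
have [Q0 [t0 [QQ0 eT0 ht0]]] := scaled_unitary_spectral r0 (T1 false) (T2 false).
have [Q1 [t1 [QQ1 eT1 ht1]]] := scaled_unitary_spectral r0 (T1 true) (T2 true).
pose Q (b : bool) := if b then Q1 else Q0.
pose t (b : bool) := if b then t1 else t0.
pose K : finType := (bool * 'I_(n + n))%type.
(* The factor 1/2 of the mean is shared by the two vectors of each rank-one term. The two
   eigenbases, scaled by [h] and cut to the first [n] coordinates, then together resolve the
   identity. *)
pose h : C := (sqrtC 2)^-1.
have hh : h * h^* = 2^-1.
  rewrite /h conj_Creal ?realV ?ger0_real ?sqrtC_ge0 //.
  by rewrite -invfM -expr2 sqrtCK.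
exists r, K, (fun k => t k.1 0 k.2), (fun k i => h * (Q k.1 k.2 (lshift n i))^*).
split=> //.
- by move=> [[] k] /=.
- move=> i j.
  have -> : O i j = 2^-1 * (T false + T true) (lshift n i) (lshift n j).
    have -> : T false + T true = 2 *: (S *m X).
      rewrite /T -!mulmxDl -mulmxDr -linearD /= eS.
      have -> : g false + g true = 2 *: d.
        by apply/rowP=> k; rewrite !mxE expr0 expr1; ring.
      by rewrite linearZ /= -scalemxAr -!scalemxAl.
    rewrite /S /X mulmx_block !(mul0mx, mulmx0, mulmx1, add0r, addr0).
    by rewrite mxE block_mxEul mxE mulrA mulVf ?mul1r // pnatr_eq0.
  rewrite eT0 eT1 mxE !unitary_diagE -big_split mulr_sumr /=.
  rewrite -(pair_bigA _ (fun b k => t b 0 k * (h * (Q b k (lshift n i))^*) *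
     (h * (Q b k (lshift n j))^*)^*)) /= exchange_big /=.
  apply: eq_bigr => k _; rewrite big_bool /= !rmorphM /= !conjCK -hh; ring.
- move=> i j.
  rewrite -(pair_bigA _ (fun b k => h * (Q b k (lshift n i))^* *
     (h * (Q b k (lshift n j))^*)^*)) /=.
  have QE (A : 'M[C]_(n + n)) : A^t* *m A = 1%:M ->
     \sum_k h * (A k (lshift n i))^* * (h * (A k (lshift n j))^*)^* = 2^-1 * (i == j)%:R.
    move/matrixP/(_ (lshift n i) (lshift n j)); rewrite !mxE (inj_eq (@lshift_inj _ _)) => <-.
    rewrite mulr_sumr; apply: eq_bigr => k _.
    by rewrite !mxE rmorphM /= conjCK -hh; ring.
  rewrite big_bool /= !QE //; case: eqP => _; rewrite ?mulr0 ?addr0 //.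
  by rewrite /= !mulr1; field.
have [->|rn0] := eqVneq r 0; first by left.
have rE : r ^+ 2 = (d 0 km) ^+ 2.
  by rewrite dl /r -!rmorphXn /= real_normK // num_real.
have ln0 : d 0 km != 0.
  by apply: contra rn0 => /eqP d0; rewrite -sqrf_eq0 rE d0 expr0n.
have dJ : (d 0 km)^* = d 0 km by apply: conj_Creal.
have PS j : \sum_i P km i * S i j = d 0 km * P km j.
  have : (P *m S) km j = (diag_mx d *m P) km j by rewrite eS !mulmxA PP mul1mx.
  by rewrite mul_diag_mx !mxE.
(* The eigenvector of [S] for [l km] has halves [a] and [b] with O b = l a and O^* a = l b.
   Computing <a, O b> both ways shows that the halves have equal norm, so [b] attains the norm
   [r]. *)
pose a j := (P km (lshift n j))^*; pose b j := (P km (rshift n j))^*.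
have Ob j : mxapp O b j = d 0 km * a j.
  have := congr1 (@Num.conj C) (PS (lshift n j)).
  rewrite big_split_ord /= big1 ?add0r => [|i _].
    rewrite rmorphM /= dJ -/(a j) => <-; rewrite rmorph_sum /mxapp.
    apply: eq_bigr => i _.
    by rewrite /S block_mxEdl !mxE rmorphM /= conjCK mulrC.
  by rewrite /S block_mxEul mxE mulr0.
have aO j : \sum_i (a i)^* * O i j = d 0 km * (b j)^*.
  have := PS (rshift n j); rewrite big_split_ord /= addrC big1 ?add0r => [|i _].
    rewrite /b conjCK => <-; apply: eq_bigr => i _.
    by rewrite /S block_mxEur !mxE /a conjCK.
  by rewrite /S block_mxEdr mxE mulr0.
have ab : vnorm2 a = vnorm2 b.
  apply: (mulfI ln0); rewrite /vnorm2 !mulr_sumr.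
  transitivity (\sum_j \sum_i (a j)^* * O j i * b i).
    apply: eq_bigr => j _; transitivity ((a j)^* * mxapp O b j).
      by rewrite Ob normCK; ring.
    by rewrite /mxapp mulr_sumr; apply: eq_bigr => i _; rewrite mulrA.
  rewrite exchange_big; apply: eq_bigr => i _ /=.
  by rewrite -mulr_suml aO normCK; ring.
have ab1 : vnorm2 a + vnorm2 b = 1.
  have /matrixP/(_ km km) := PP; rewrite !mxE eqxx /= mulr1n => <-.
  rewrite big_split_ord /=; congr (_ + _); apply: eq_bigr => j _;
    by rewrite !mxE normCK conjCK mulrC.
right; exists b.
  have: 0 < vnorm2 b + vnorm2 b by rewrite -{1}ab ab1 ltr01.
  by rewrite -mulr2n pmulrn_lgt0.
rewrite -ab rE /vnorm2 mulr_sumr; apply: eq_bigr => j _.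
by rewrite Ob normrM exprMn real_normK.
Qed.
End Contraction.

(** * Superoperators, amplification and LOCC maps *)

Section Locc.
Variable R : realType.
Local Notation C := R[i].

Lemma sum_pair (V : nmodType) (X Y : finType) (F : X * Y -> V) :
  \sum_p F p = \sum_x \sum_y F (x, y).
Proof. by rewrite pair_bigA; apply: eq_bigr => -[]. Qed.

Lemma sop_linear_sum (X Y : finType) (F : sop R X Y) (I : Type) (s : seq I)
    (c : I -> C) (M : I -> mx R X X) : sop_linear F ->
  F (fun x y => \sum_(i <- s) c i * M i x y) =
  fun x y => \sum_(i <- s) c i * F (M i) x y.
Proof.
move=> linF; elim: s => [|i s IHs]; last first.
  transitivity (F (fun x y => c i * M i x y + \sum_(j <- s) c j * M j x y)).
    by congr F; do 2!apply/funext => ?; rewrite big_cons.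
  by rewrite linF IHs; do 2!apply/funext => ?; rewrite big_cons.
(* Linearity at the scalar -1 and two zero matrices reads F 0 = - F 0 + F 0, which forces F 0 =
   0. *)
have -> : (fun x y => \sum_(i <- [::]) c i * M i x y) = (fun x y => (-1) * 0 + 0) :> mx R X X.
  by do 2!apply/funext => ?; rewrite big_nil mulr0 addr0.
rewrite (linF (-1) (fun _ _ => 0) (fun _ _ => 0)).
by do 2!apply/funext => ?; rewrite big_nil mulN1r addNr.
Qed.

Lemma sop_matrix_units (X Y : finType) (F : sop R X Y) (M : mx R X X) p q :
  sop_linear F -> F M p q = \sum_a \sum_b M a b * F (ematrix R a b) p q.
Proof.
move=> linF; rewrite pair_bigA /=.
rewrite -[RHS]/((fun p q => \sum_ab M ab.1 ab.2 * F (ematrix R ab.1 ab.2) p q) p q).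
rewrite -(sop_linear_sum _ (fun ab : X * X => M ab.1 ab.2) (fun ab => ematrix R ab.1 ab.2)) //.
congr (F _ p q); apply/funext => x; apply/funext => y.
rewrite (bigD1 (x, y)) //= /ematrix !eqxx mulr1 big1 ?addr0 // => -[a b] /=.
by rewrite xpair_eqE eq_sym [b == _]eq_sym => /negPf ->; rewrite mulr0.
Qed.

(** Expanding both inputs in matrix units, on which [stens] is defined, reduces the claim to
    linearity of the two factors. *)
Lemma stens_prod (X1 Y1 X2 Y2 : finType) (F : sop R X1 Y1) (G : sop R X2 Y2)
    (M : mx R X1 X1) (N : mx R X2 X2) p q : sop_linear F -> sop_linear G ->
  stens F G (fun x x' => M x.1 x'.1 * N x.2 x'.2) p q = F M p.1 q.1 * G N p.2 q.2.
Proof.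
move=> linF linG; rewrite (sop_matrix_units M _ _ linF) (sop_matrix_units N _ _ linG) /stens.
rewrite mulr_suml sum_pair /=.
apply: eq_bigr => a1 _; rewrite mulr_suml.
under eq_bigr do rewrite sum_pair /=.
rewrite exchange_big /=; apply: eq_bigr => b1 _; rewrite mulr_sumr.
by apply: eq_bigr => a2 _; rewrite mulr_sumr; apply: eq_bigr => b2 _; ring.
Qed.

(** The trace splits over the reference index into traces of diagonal blocks, and trace preservation
    of the summed instrument applies to each block. *)
Lemma mtrace_ampl (X Y K : finType) (E : K -> sop R X Y) n
    (P : mx R (X * 'I_n) (X * 'I_n)) :
  tp_map (fun rho x y => \sum_k E k rho x y) ->
  \sum_k mtrace (ampl (E k) P) = mtrace P.
Proof.
move=> tpE; rewrite /mtrace exchange_big /=.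
rewrite sum_pair /=.
rewrite exchange_big sum_pair [RHS]exchange_big /=.
by apply: eq_bigr => i _; apply: (tpE (fun x x' => P (x, i) (x', i))).
Qed.

Lemma psd_mtrace_ge0 (X : finType) (P : mx R X X) : psd P -> 0 <= mtrace P.
Proof.
move=> /psd_rank1 [v hv]; apply: sumr_ge0 => x _; rewrite hv.
by apply: sumr_ge0 => k _; rewrite mul_conjC_ge0.
Qed.

(** The index groups the row and column of [P] in [t.1] and those of [Q] in [t.2], so that one party
    can be transformed while the other stays fixed. *)
Definition bilin_val (X Y : finType) (W : (X * X) * (Y * Y) -> C)
    (P : mx R X X) (Q : mx R Y Y) : C :=
  \sum_t W t * (P t.1.1 t.1.2 * Q t.2.1 t.2.2).

(* The functional [W] evaluated at (F (x) id)(P (x) Q), where the references are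
   ['I_n] on Alice's side and ['I_n'] on Bob's. *)
Definition ampl_val (XA XB YA YB : finType) n n' (F : sop R (XA * XB) (YA * YB))
    (W : ((YA * 'I_n) * (YA * 'I_n)) * ((YB * 'I_n') * (YB * 'I_n')) -> C)
    (P : mx R (XA * 'I_n) (XA * 'I_n)) (Q : mx R (XB * 'I_n') (XB * 'I_n')) : C :=
  \sum_t W t * F (fun x x' => P (x.1, t.1.1.2) (x'.1, t.1.2.2) *
                              Q (x.2, t.2.1.2) (x'.2, t.2.2.2))
                 (t.1.1.1, t.2.1.1) (t.1.2.1, t.2.2.1).

(* An LOCC map sends products of positive operators to sums of such products,
   so a bound on the product operators survives it. *)
Lemma LOCC_bound (XA XB YA YB : finType) (F : sop R (XA * XB) (YA * YB)) :
  LOCC F -> forall n n' W (D : C),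
  (forall P Q, psd P -> psd Q ->
     `|bilin_val W P Q| <= D * (mtrace P * mtrace Q)) ->
  forall P Q, psd P -> psd Q ->
     `|@ampl_val _ _ _ _ n n' F W P Q| <= D * (mtrace P * mtrace Q).
Proof.
have slin (X : finType) : sop_linear (sid R X) by [].
elim=> {XA XB YA YB F}.
- move=> XA XB YA YB F G [cpF tpF] [cpG tpG] n n' W D hW P Q pP pQ.
  (* A channel is an instrument with the single outcome of [unit]. *)
  have one (X Y : finType) (H : sop R X Y) m (S : mx R (X * 'I_m) (X * 'I_m)) :
      tp_map H -> mtrace S = mtrace (ampl H S).
    move=> tpH; rewrite -(@mtrace_ampl _ _ unit (fun=> H)) ?big_const ?card_unit /= ?addr0 //.
    move=> rho; rewrite -[RHS]tpH; congr mtrace; do 2!apply/funext => ?.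
    by rewrite big_const card_unit /= addr0.
  rewrite (one _ _ F) // (one _ _ G) //.
  have -> : ampl_val (stens F G) W P Q = bilin_val W (ampl F P) (ampl G Q).
    apply: eq_bigr => t _; congr (_ * _).
    by rewrite (stens_prod (fun x x' => P (x, _) (x', _)) (fun x x' => Q (x, _) (x', _))) //;
      [case: cpF | case: cpG].
  by apply: hW; [case: cpF => _; apply | case: cpG => _; apply].
- move=> XA XB ZA YA YB K E F [cpE tpE] _ IH n n' W D hW P Q pP pQ.
  have -> : ampl_val (fun rho x y => \sum_k F k (stens (E k) (sid R XB) rho) x y) W P Q =
            \sum_k ampl_val (F k) W (ampl (E k) P) Q.
    rewrite /ampl_val exchange_big; apply: eq_bigr => t _; rewrite mulr_sumr.
    apply: eq_bigr => k _; congr (_ * F k _ _ _); do 2!apply/funext => ?.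
    by rewrite (stens_prod (fun x x' => P (x, _) (x', _)) (fun x x' => Q (x, _) (x', _))) //;
      case: (cpE k).
  apply: le_trans (ler_norm_sum _ _ _) _.
  (* The bound is linear in the trace of [P], so the bounds for the separate outcomes add up exactly
     to the one required. *)
  rewrite -(mtrace_ampl P tpE) mulr_suml mulr_sumr; apply: ler_sum => k _.
  by apply: IH => //; case: (cpE k) => _; apply.
- move=> XA XB ZB YA YB K E F [cpE tpE] _ IH n n' W D hW P Q pP pQ.
  have -> : ampl_val (fun rho x y => \sum_k F k (stens (sid R XA) (E k) rho) x y) W P Q =
            \sum_k ampl_val (F k) W P (ampl (E k) Q).
    rewrite /ampl_val exchange_big; apply: eq_bigr => t _; rewrite mulr_sumr.
    apply: eq_bigr => k _; congr (_ * F k _ _ _); do 2!apply/funext => ?.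
    by rewrite (stens_prod (fun x x' => P (x, _) (x', _)) (fun x x' => Q (x, _) (x', _))) //;
      case: (cpE k).
  apply: le_trans (ler_norm_sum _ _ _) _.
  rewrite -(mtrace_ampl Q tpE) !mulr_sumr; apply: ler_sum => k _.
  by apply: IH => //; case: (cpE k) => _; apply.
Qed.
End Locc.

(** * The Schmidt witness and its bound on product operators *)

Section Witness.
Variable R : realType.
Local Notation C := R[i].

Lemma vnorm2_tens (X Y : finType) (u : X -> C) (v : Y -> C) :
  vnorm2 (fun p => u p.1 * v p.2) = vnorm2 u * vnorm2 v.
Proof.
rewrite /vnorm2 mulr_suml sum_pair /=.
apply: eq_bigr => x _; rewrite mulr_sumr; apply: eq_bigr => y _.
by rewrite normrM exprMn.
Qed.

Lemma mxapp_tens (X1 Y1 X2 Y2 : finType) (M : mx R X1 Y1) (N : mx R X2 Y2) u v :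
  mxapp (mxtens M N) (fun p => u p.1 * v p.2) = fun p => mxapp M u p.1 * mxapp N v p.2.
Proof.
apply/funext => -[x1 x2]; rewrite /mxapp mulr_suml /=.
rewrite sum_pair /=.
apply: eq_bigr => y1 _; rewrite mulr_sumr; apply: eq_bigr => y2 _.
by rewrite /mxtens /=; ring.
Qed.

(** The product of two vectors attaining the norms [r] and [s] is a test vector for the tensor
    product. Only the product of the two norms gets bounded, not each norm alone. *)
Lemma opnorm_tens_le1 (X1 Y1 X2 Y2 : finType) (M : mx R X1 Y1) (N : mx R X2 Y2) (r s : C) :
  opnorm_le1 (mxtens M N) -> 0 <= r -> 0 <= s ->
  (r = 0 \/ exists2 b, 0 < vnorm2 b & vnorm2 (mxapp M b) = r ^+ 2 * vnorm2 b) ->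
  (s = 0 \/ exists2 b, 0 < vnorm2 b & vnorm2 (mxapp N b) = s ^+ 2 * vnorm2 b) ->
  r * s <= 1.
Proof.
move=> hMN r0 s0 [->|[b b0 eb]]; first by rewrite mul0r ler01.
move=> [->|[b' b0' eb']]; first by rewrite mulr0 ler01.
have := hMN (fun p => b p.1 * b' p.2); rewrite mxapp_tens !vnorm2_tens eb eb'.
rewrite mulrACA -exprMn ger_pMl ?mulr_gt0 // => h.
by rewrite -(expr_le1 (n := 2)) // mulr_ge0.
Qed.

Lemma vnorm2_ge0 (X : finType) (u : X -> C) : 0 <= vnorm2 u.
Proof. by apply: sumr_ge0 => x _; rewrite exprn_ge0. Qed.

(** Lagrange's identity: the double sum of squares is twice the defect of the inequality. *)
Lemma cauchy_schwarz (J : finType) (a b : J -> C) :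
  `|\sum_j a j * b j| ^+ 2 <= vnorm2 a * vnorm2 b.
Proof.
have : 0 <= \sum_j \sum_k `|a j * (b k)^* - a k * (b j)^*| ^+ 2.
  by apply: sumr_ge0 => j _; apply: sumr_ge0 => k _; rewrite exprn_ge0.
set s := \sum_j _ * _.
have -> : \sum_j \sum_k `|a j * (b k)^* - a k * (b j)^*| ^+ 2 =
          \sum_j \sum_k (`|a j| ^+ 2 * `|b k| ^+ 2) + \sum_j \sum_k (`|a k| ^+ 2 * `|b j| ^+ 2)
          - (\sum_j \sum_k (a j * b j) * (a k * b k)^* + \sum_j \sum_k (a j * b j)^* * (a k * b k)).
  rewrite -!big_split -sumrB; apply: eq_bigr => j _ /=.
  rewrite -!big_split -sumrB; apply: eq_bigr => k _ /=.
  by rewrite !normCK rmorphB !rmorphM /= !conjCK; ring.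
have -> : \sum_j \sum_k (a j * b j) * (a k * b k)^* = `|s| ^+ 2.
  rewrite normCK /s rmorph_sum mulr_suml; apply: eq_bigr => j _.
  by rewrite mulr_sumr.
have -> : \sum_j \sum_k (a j * b j)^* * (a k * b k) = `|s| ^+ 2.
  rewrite normCKC /s rmorph_sum mulr_suml; apply: eq_bigr => j _.
  by rewrite mulr_sumr.
rewrite [X in _ + X - _]exchange_big /=.
have -> : \sum_j \sum_k (`|a j| ^+ 2 * `|b k| ^+ 2) = vnorm2 a * vnorm2 b.
  by rewrite /vnorm2 mulr_suml; apply: eq_bigr => j _; rewrite mulr_sumr.
by rewrite -!mulr2n subr_ge0 lerMn2r.
Qed.

(** The common squared norm [d] matches the normalisation Tr(A_j^* A_k) = d_A delta_jk of Schmidt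
    operators. *)
Definition orthofamily (X J : finType) (f : J -> X -> C) (d : C) :=
  forall j k, \sum_x (f j x)^* * f k x = d * (j == k)%:R.

(** The projection of [u] to the span is (1/d) sum_j c_j f_j. Expanding the squared norm of [d]
    times the residual gives d (d |u|^2 - sum_j |c_j|^2) without a division. *)
Lemma bessel (X J : finType) (f : J -> X -> C) (d : C) (u : X -> C) :
  0 < d -> orthofamily f d ->
  \sum_j `|\sum_x (f j x)^* * u x| ^+ 2 <= d * vnorm2 u.
Proof.
move=> d0 hf; set c := fun j => \sum_x (f j x)^* * u x.
have dJ : d^* = d by apply: conj_Creal; rewrite gtr0_real.
have : 0 <= \sum_x `|d * u x - \sum_j c j * f j x| ^+ 2.
  by apply: sumr_ge0 => x _; rewrite exprn_ge0.
have cu : \sum_x u x * (\sum_j c j * f j x)^* = \sum_j `|c j| ^+ 2.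
  under eq_bigr do rewrite rmorph_sum mulr_sumr.
  rewrite exchange_big; apply: eq_bigr => j _ /=.
  rewrite normCKC {2}/c mulr_sumr; apply: eq_bigr => x _.
  by rewrite rmorphM /=; ring.
have cu' : \sum_x (u x)^* * (\sum_j c j * f j x) = \sum_j `|c j| ^+ 2.
  have := congr1 (@Num.conj C) cu; rewrite !rmorph_sum /= => e.
  transitivity (\sum_j (`|c j| ^+ 2)^*).
    by rewrite -e; apply: eq_bigr => x _; rewrite rmorphM /= conjCK.
  by apply: eq_bigr => j _; rewrite rmorphXn /= conj_normC.
have cc : \sum_x (\sum_j c j * f j x) * (\sum_j c j * f j x)^* = d * \sum_j `|c j| ^+ 2.
  under eq_bigr do rewrite rmorph_sum mulr_suml.
  rewrite exchange_big mulr_sumr; apply: eq_bigr => j _ /=.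
  under eq_bigr do rewrite mulr_sumr.
  rewrite exchange_big /= (bigD1 j) //= [X in _ + X]big1 ?addr0 => [|k kj].
    transitivity (`|c j| ^+ 2 * \sum_x (f j x)^* * f j x); last first.
      by rewrite hf eqxx mulr1 mulrC.
    by rewrite mulr_sumr; apply: eq_bigr => x _; rewrite rmorphM normCK /=; ring.
  transitivity (c j * (c k)^* * \sum_x (f k x)^* * f j x); last first.
    by rewrite hf (negPf kj) !mulr0.
  by rewrite mulr_sumr; apply: eq_bigr => x _; rewrite rmorphM /=; ring.
have -> : \sum_x `|d * u x - \sum_j c j * f j x| ^+ 2 =
    d * (d * vnorm2 u - \sum_j `|c j| ^+ 2).
  transitivity (d * (d * vnorm2 u)
      - d * (\sum_x u x * (\sum_j c j * f j x)^*) - d * (\sum_x (u x)^* * (\sum_j c j * f j x))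
      + \sum_x (\sum_j c j * f j x) * (\sum_j c j * f j x)^*); last first.
    by rewrite cu cu' cc; ring.
  rewrite /vnorm2 !mulr_sumr -!sumrB -big_split; apply: eq_bigr => x _ /=.
  by rewrite !normCK rmorphB rmorphM /= dJ; ring.
by rewrite pmulr_rge0 // subr_ge0.
Qed.

Definition schmidt_vec (X Y J : finType) (f : J -> X -> C) (g : J -> Y -> C) x y : C :=
  \sum_j f j x * g j y.

(** These are the entries of the transpose of H = 2 |Phi><Phi| - d, so that summing against the
    entries of an operator gives its trace against H. *)
Definition schmidt_witness (X Y J : finType) (f : J -> X -> C) (g : J -> Y -> C)
    (d : C) (t : (X * X) * (Y * Y)) : C :=
  2 * ((schmidt_vec f g t.1.1 t.2.1)^* * schmidt_vec f g t.1.2 t.2.2)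
  - d * ((t.1.1 == t.1.2)%:R * (t.2.1 == t.2.2)%:R).

Lemma mtrace_rank1 (X K : finType) (P : mx R X X) (u : K -> X -> C) :
  (forall x y, P x y = \sum_k u k x * (u k y)^*) -> mtrace P = \sum_k vnorm2 (u k).
Proof.
move=> hP; rewrite /mtrace exchange_big /=; apply: eq_bigr => x _.
by rewrite hP; apply: eq_bigr => k _; rewrite normCK.
Qed.

Lemma sum_pair4 (X1 X2 Y1 Y2 : finType) (G : (X1 * X2) * (Y1 * Y2) -> C) :
  \sum_t G t = \sum_x1 \sum_x2 \sum_y1 \sum_y2 G ((x1, x2), (y1, y2)).
Proof.
by rewrite !sum_pair; do 2!(apply: eq_bigr => ? _); rewrite sum_pair.
Qed.

Lemma schmidt_witness_pure (X Y J : finType) (f : J -> X -> C) (g : J -> Y -> C)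
    (d : C) (psi : X -> Y -> C) :
  \sum_t schmidt_witness f g d t * (psi t.1.1 t.2.1 * (psi t.1.2 t.2.2)^*) =
  2 * `|\sum_s (schmidt_vec f g s.1 s.2)^* * psi s.1 s.2| ^+ 2
  - d * vnorm2 (fun s => psi s.1 s.2).
Proof.
transitivity (2 * (\sum_t (schmidt_vec f g t.1.1 t.2.1)^* * schmidt_vec f g t.1.2 t.2.2 *
      (psi t.1.1 t.2.1 * (psi t.1.2 t.2.2)^*)) -
    d * \sum_(t : (X * X) * (Y * Y))
      (t.1.1 == t.1.2)%:R * (t.2.1 == t.2.2)%:R * (psi t.1.1 t.2.1 * (psi t.1.2 t.2.2)^*)).
  rewrite !mulr_sumr -sumrB; apply: eq_bigr => t _.
  by rewrite /schmidt_witness; ring.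
congr (2 * _ - d * _); rewrite sum_pair4 /=.
  rewrite normCK rmorph_sum mulr_suml.
  rewrite sum_pair /=.
  apply: eq_bigr => x _; rewrite exchange_big; apply: eq_bigr => y _ /=.
  rewrite sum_pair /=.
  rewrite mulr_sumr; apply: eq_bigr => x' _; rewrite mulr_sumr; apply: eq_bigr => y' _.
  by rewrite !rmorphM /= conjCK; ring.
rewrite /vnorm2 sum_pair /=; apply: eq_bigr => x _.
rewrite (bigD1 x) //= [X in _ + X]big1 ?addr0 => [|x' x'x]; last first.
  by rewrite eq_sym (negPf x'x) big1 // => y _; rewrite big1 // => y' _; rewrite !mul0r.
apply: eq_bigr => y _.
rewrite (bigD1 y) //= [X in _ + X]big1 ?addr0 => [|y' y'y]; last first.
  by rewrite (eq_sym y) (negPf y'y) mulr0 mul0r.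
by rewrite !eqxx !mul1r normCK.
Qed.

(** Rank-one decompositions reduce the claim to product vectors, where <Phi, u (x) v> = sum_j <f_j,
    u> <g_j, v>. Its squared modulus lies in [0, m] with m = a b |u|^2 |v|^2; doubling it and
    subtracting [m] centres this interval to [-m, m]. *)
Lemma schmidt_witness_bound (X Y J : finType) (f : J -> X -> C) (g : J -> Y -> C)
    (a b : C) (P : mx R X X) (Q : mx R Y Y) :
  0 < a -> 0 < b -> orthofamily f a -> orthofamily g b -> psd P -> psd Q ->
  `|bilin_val (schmidt_witness f g (a * b)) P Q| <= a * b * (mtrace P * mtrace Q).
Proof.
move=> a0 b0 hf hg /psd_rank1 [u hP] /psd_rank1 [v hQ].
pose w k l := \sum_t schmidt_witness f g (a * b) t *
  (u k t.1.1 * v l t.2.1 * (u k t.1.2 * v l t.2.2)^*).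
have -> : bilin_val (schmidt_witness f g (a * b)) P Q = \sum_k \sum_l w k l.
  under [RHS]eq_bigr do rewrite exchange_big.
  rewrite [RHS]exchange_big; apply: eq_bigr => t _ /=.
  rewrite hP hQ mulr_suml mulr_sumr; apply: eq_bigr => k _.
  by rewrite !mulr_sumr; apply: eq_bigr => l _; rewrite rmorphM /=; ring.
rewrite (mtrace_rank1 hP) (mtrace_rank1 hQ) mulr_suml mulr_sumr.
apply: le_trans (ler_norm_sum _ _ _) _; apply: ler_sum => k _.
apply: le_trans (ler_norm_sum _ _ _) _; rewrite !mulr_sumr; apply: ler_sum => l _.
rewrite /w (schmidt_witness_pure f g (a * b) (fun x y => u k x * v l y)) vnorm2_tens.
set z := \sum_s _.
have z_le : `|z| ^+ 2 <= a * b * (vnorm2 (u k) * vnorm2 (v l)).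
  have -> : z = \sum_j (\sum_x (f j x)^* * u k x) * (\sum_y (g j y)^* * v l y).
    rewrite /z sum_pair /=.
    transitivity (\sum_j \sum_x \sum_y (f j x * g j y)^* * (u k x * v l y)); last first.
      apply: eq_bigr => j _; rewrite mulr_suml; apply: eq_bigr => x _.
      by rewrite mulr_sumr; apply: eq_bigr => y _; rewrite rmorphM /=; ring.
    rewrite [RHS]exchange_big; apply: eq_bigr => x _ /=; rewrite exchange_big.
    by apply: eq_bigr => y _ /=; rewrite rmorph_sum mulr_suml.
  apply: le_trans (cauchy_schwarz _ _) _; rewrite mulrACA.
  by apply: ler_pM; rewrite ?vnorm2_ge0 // bessel.
move: z_le; set m := a * b * _ => z_le.
have m0 : 0 <= m by apply: le_trans z_le; rewrite exprn_ge0.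
rewrite real_ler_norml; last by rewrite rpredB // ger0_real // mulr_ge0 // exprn_ge0.
apply/andP; split.
  by rewrite -[leLHS]add0r lerD2r mulr_ge0 // exprn_ge0.
by rewrite lerBlDr -mulr2n mulr_natl lerMn2r.
Qed.
End Witness.

(** * Product observables reduced to compressions of positive operators *)

Section Observable.
Variable R : realType.
Local Notation C := R[i].

(** This is (1 (x) <e|) P (1 (x) |e>). The coordinate maps [p] and [q] replace a literal product
    [X * S] because the ancilla will sit between system and reference in the index triples. *)
Definition compress (Z X S : finType) (p : Z -> X) (q : Z -> S) (e : S -> C)
    (P : mx R Z Z) : mx R X X :=
  fun x y => \sum_(z | p z == x) \sum_(w | p w == y) (e (q z))^* * e (q w) * P z w.

Lemma sum_compress (Z X S : finType) (p : Z -> X) (q : Z -> S) (e : S -> C)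
    (P : mx R Z Z) (G : X * X -> C) :
  \sum_t G t * compress p q e P t.1 t.2 =
  \sum_t G (p t.1, p t.2) * ((e (q t.1))^* * e (q t.2) * P t.1 t.2).
Proof.
rewrite [RHS]sum_pair /=.
transitivity (\sum_x \sum_y G (x, y) * compress p q e P x y).
  by rewrite sum_pair.
rewrite [RHS](partition_big p predT) //=; apply: eq_bigr => x _.
rewrite [RHS]exchange_big [RHS](partition_big p predT) //=; apply: eq_bigr => y _.
rewrite /compress exchange_big mulr_sumr; apply: eq_bigr => w /eqP pw.
by rewrite mulr_sumr; apply: eq_bigr => z /eqP pz; rewrite pw pz.
Qed.

Lemma psd_compress (Z X S : finType) (p : Z -> X) (q : Z -> S) (e : S -> C)
    (P : mx R Z Z) : psd P -> psd (compress p q e P).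
Proof.
move=> pP v; rewrite pair_bigA /=.
have := pP (fun z => e (q z) * v (p z)); rewrite pair_bigA /=.
congr (0 <= _); transitivity (\sum_t (v t.1)^* * v t.2 * compress p q e P t.1 t.2).
  rewrite (sum_compress p q e P (fun t => (v t.1)^* * v t.2)).
  by apply: eq_bigr => t _; rewrite rmorphM /=; ring.
by apply: eq_bigr => t _; ring.
Qed.

(** The resolution of the identity forces equal ancilla coordinates and the trace forces equal
    coordinates in [X]; by injectivity only the diagonal of [P] remains. *)
Lemma mtrace_compress (Z X S K : finType) (p : Z -> X) (q : Z -> S) (e : K -> S -> C)
    (P : mx R Z Z) :
  injective (fun z => (p z, q z)) ->
  (forall i j, \sum_k e k i * (e k j)^* = (i == j)%:R) ->
  \sum_k mtrace (compress p q (e k) P) = mtrace P.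
Proof.
move=> inj_pq he.
have trE (M : mx R X X) : mtrace M = \sum_t (t.1 == t.2)%:R * M t.1 t.2.
  rewrite sum_pair /=; apply: eq_bigr => x _.
  rewrite (bigD1 x) //= eqxx mul1r big1 ?addr0 // => y.
  by rewrite eq_sym => /negPf ->; rewrite mul0r.
under eq_bigr do rewrite trE (sum_compress p q _ P (fun t => (t.1 == t.2)%:R)) /=.
rewrite exchange_big /=.
rewrite sum_pair /=.
apply: eq_bigr => z _.
have E w : \sum_k (p z == p w)%:R * ((e k (q z))^* * e k (q w) * P z w) = (z == w)%:R * P z w.
  transitivity ((p z == p w)%:R * (\sum_k e k (q w) * (e k (q z))^*) * P z w).
    by rewrite mulr_sumr mulr_suml; apply: eq_bigr => k _; ring.
  rewrite he (eq_sym (q w)) -natrM mulnb; congr (_%:R * _); congr nat_of_bool.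
  by apply/andP/eqP => [[/eqP a /eqP b]|->//]; apply: inj_pq; rewrite /= a b.
under eq_bigr do rewrite E.
rewrite (bigD1 z) //= eqxx mul1r big1 ?addr0 // => y.
by rewrite eq_sym => /negPf ->; rewrite mul0r.
Qed.

(** Inserting both decompositions gives a sum over [k] and [l] of pairings of compressed operators.
    Every coefficient has the same modulus r s and the compressed traces add up to the original
    ones, so the number of terms costs nothing. *)
Lemma observable_bound (Z X S Z' Y S' : finType) (p : Z -> X) (q : Z -> S)
    (p' : Z' -> Y) (q' : Z' -> S') (K L : finType) (mu : K -> C) (nu : L -> C)
    (e : K -> S -> C) (e' : L -> S' -> C) (r s D : C) (W : (X * X) * (Y * Y) -> C) 
    (OA : mx R S S) (OB : mx R S' S') :
  injective (fun z => (p z, q z)) -> injective (fun z => (p' z, q' z)) ->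
  0 <= r -> 0 <= s -> (forall k, `|mu k| = r) -> (forall l, `|nu l| = s) ->
  (forall i j, OA i j = \sum_k mu k * e k i * (e k j)^*) ->
  (forall i j, OB i j = \sum_l nu l * e' l i * (e' l j)^*) ->
  (forall i j, \sum_k e k i * (e k j)^* = (i == j)%:R) ->
  (forall i j, \sum_l e' l i * (e' l j)^* = (i == j)%:R) ->
  (forall P Q, psd P -> psd Q -> `|bilin_val W P Q| <= D * (mtrace P * mtrace Q)) ->
  forall P Q, psd P -> psd Q ->
  `|bilin_val (fun t => W ((p t.1.1, p t.1.2), (p' t.2.1, p' t.2.2)) *
       (OA (q t.1.2) (q t.1.1) * OB (q' t.2.2) (q' t.2.1))) P Q|
  <= r * s * (D * (mtrace P * mtrace Q)).
Proof.
move=> injp injp' r0 s0 hmu hnu eA eB he he' hW P Q pP pQ.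
set B := bilin_val _ _ _.
have -> : B = \sum_k \sum_l mu k * nu l *
    bilin_val W (compress p q (e k) P) (compress p' q' (e' l) Q).
  have CC k l : bilin_val W (compress p q (e k) P) (compress p' q' (e' l) Q) =
    \sum_t \sum_s W ((p t.1, p t.2), (p' s.1, p' s.2)) *
      (((e k (q t.1))^* * e k (q t.2) * P t.1 t.2) *
       ((e' l (q' s.1))^* * e' l (q' s.2) * Q s.1 s.2)).
    transitivity (\sum_t (\sum_s W (t, s) * compress p' q' (e' l) Q s.1 s.2) *
        compress p q (e k) P t.1 t.2).
      transitivity (\sum_t \sum_s W (t, s) *
         (compress p q (e k) P t.1 t.2 * compress p' q' (e' l) Q s.1 s.2)).
        by rewrite /bilin_val sum_pair.
      apply: eq_bigr => t _; rewrite mulr_suml; apply: eq_bigr => s' _; ring.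
    rewrite (sum_compress p q _ P (fun t => \sum_s W (t, s) * compress p' q' (e' l) Q s.1 s.2)).
    apply: eq_bigr => t _; rewrite (sum_compress p' q' _ Q (fun s => W (_, s))) mulr_suml.
    by apply: eq_bigr => s' _; ring.
  under eq_bigr do under eq_bigr do rewrite CC mulr_sumr.
  under eq_bigr do rewrite exchange_big /=.
  rewrite exchange_big /=.
  transitivity (\sum_t \sum_s W ((p t.1, p t.2), (p' s.1, p' s.2)) *
       (OA (q t.2) (q t.1) * OB (q' s.2) (q' s.1)) * (P t.1 t.2 * Q s.1 s.2)).
    by rewrite /B /bilin_val sum_pair.
  apply: eq_bigr => t _.
  under [RHS]eq_bigr do under eq_bigr do rewrite mulr_sumr.
  under [RHS]eq_bigr do rewrite exchange_big /=.
  rewrite [RHS]exchange_big; apply: eq_bigr => s' _ /=.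
  rewrite eA eB mulr_suml mulr_sumr mulr_suml; apply: eq_bigr => k _.
  by rewrite !mulr_sumr mulr_suml; apply: eq_bigr => l _; ring.
apply: le_trans (ler_norm_sum _ _ _) _.
rewrite -(mtrace_compress P injp he) -(mtrace_compress Q injp' he') mulr_suml !mulr_sumr.
apply: ler_sum => k _; apply: le_trans (ler_norm_sum _ _ _) _.
rewrite !mulr_sumr; apply: ler_sum => l _.
rewrite !normrM hmu hnu; apply: ler_wpM2l; first by rewrite mulr_ge0.
by apply: hW; apply: psd_compress.
Qed.

Lemma product_observable_bound (Z X Z' Y : finType) (m m' : nat) (p : Z -> X) (q : Z -> 'I_m)
    (p' : Z' -> Y) (q' : Z' -> 'I_m') (D : C) (W : (X * X) * (Y * Y) -> C)
    (OA : mx R 'I_m 'I_m) (OB : mx R 'I_m' 'I_m') :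
  injective (fun z => (p z, q z)) -> injective (fun z => (p' z, q' z)) ->
  opnorm_le1 (mxtens OA OB) -> 0 <= D ->
  (forall P Q, psd P -> psd Q -> `|bilin_val W P Q| <= D * (mtrace P * mtrace Q)) ->
  forall P Q, psd P -> psd Q ->
  `|bilin_val (fun t => W ((p t.1.1, p t.1.2), (p' t.2.1, p' t.2.2)) *
       (OA (q t.1.2) (q t.1.1) * OB (q' t.2.2) (q' t.2.1))) P Q|
  <= D * (mtrace P * mtrace Q).
Proof.
move=> injp injp' hO D0 hW P Q pP pQ.
have [r [K [mu [e [r0 hmu eA he nA]]]]] := phase_decomposition OA.
have [s [L [nu [e' [s0 hnu eB he' nB]]]]] := phase_decomposition OB.
apply: le_trans (observable_bound injp injp' r0 s0 hmu hnu eA eB he he' hW pP pQ) _.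
rewrite ler_piMl ?(opnorm_tens_le1 hO) //.
by rewrite !mulr_ge0 // psd_mtrace_ge0.
Qed.

End Observable.

(** * Lower bound on the 1-norm of a space-like cut *)

Section LowerBound.
Variable R : realType.
Local Notation C := R[i].

Definition maxent (X : finType) : mx R (X * X) (X * X) :=
  fun p q => (p.1 == p.2)%:R * (q.1 == q.2)%:R.

Lemma psd_maxent (X : finType) : psd (@maxent X).
Proof.
move=> v; suff -> : \sum_x \sum_y (v x)^* * maxent x y * v y =
    `|\sum_x (x.1 == x.2)%:R * v x| ^+ 2 by rewrite exprn_ge0.
rewrite normCKC rmorph_sum mulr_suml; apply: eq_bigr => x _.
by rewrite mulr_sumr; apply: eq_bigr => y _; rewrite rmorphM /= conjC_nat /maxent; ring.
Qed.

Lemma mtrace_maxent (X : finType) : mtrace (@maxent X) = #|X|%:R.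
Proof.
rewrite /mtrace sum_pair /=.
rewrite -sum1_card natr_sum; apply: eq_bigr => x _.
rewrite (bigD1 x) //= [X in _ + X]big1 ?addr0 /maxent /= ?eqxx ?mulr1 // => y.
by rewrite eq_sym => /negPf ->; rewrite mul0r.
Qed.

(** The output is the Choi operator of the conjugation by [U]: the rank-one operator on vec(U), with
    indices regrouped as Alice and her reference against Bob and his. *)
Lemma ampl_val_iso_conj_maxent (dA dB : nat) (U : mx R ('I_dA * 'I_dB) ('I_dA * 'I_dB)) W :
  ampl_val (iso_conj U) W (@maxent 'I_dA) (@maxent 'I_dB) =
  \sum_t W t * (U (t.1.1.1, t.2.1.1) (t.1.1.2, t.2.1.2) *
               (U (t.1.2.1, t.2.2.1) (t.1.2.2, t.2.2.2))^*).
Proof.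
apply: eq_bigr => -[[p q] [p' q']] _ /=; congr (_ * _).
rewrite /iso_conj /mxmul (bigD1 (q.2, q'.2)) //= [X in _ + X]big1 ?addr0 => [|y yq]; last first.
  rewrite big1 ?mul0r // => x _; rewrite /maxent /=.
  move: yq; rewrite -pair_eqE /pair_eq /= negb_and.
  by case/orP => /negPf ->; rewrite !(mulr0, mul0r).
rewrite (bigD1 (p.2, p'.2)) //= [X in _ + X]big1 ?addr0 => [|y yp]; last first.
  rewrite /maxent /=; move: yp; rewrite -pair_eqE /pair_eq /= negb_and.
  by case/orP => /negPf ->; rewrite !(mulr0, mul0r).
by rewrite /maxent /= !eqxx !mulr1.
Qed.

(** The observable moves from the map into the functional, which leaves the bare map [E] to which
    [LOCC_bound] applies. *)
Lemma ampl_val_idT (dA dB dRA dRB : nat) (E : sop R ('I_dA * 'I_dB) (('I_dA * 'I_dRA) * ('I_dB * 'I_dRB)))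
    (OA : mx R 'I_dRA 'I_dRA) (OB : mx R 'I_dRB 'I_dRB) n n'
    (W : (('I_dA * 'I_n) * ('I_dA * 'I_n)) * (('I_dB * 'I_n') * ('I_dB * 'I_n')) -> C) P Q :
  ampl_val (fun rho => idT (mxtens OA OB) (E rho)) W P Q =
  ampl_val E (fun t => W (((t.1.1.1.1, t.1.1.2), (t.1.2.1.1, t.1.2.2)),
                          ((t.2.1.1.1, t.2.1.2), (t.2.2.1.1, t.2.2.2))) *
                       (OA t.1.2.1.2 t.1.1.1.2 * OB t.2.2.1.2 t.2.1.1.2)) P Q.
Proof.
rewrite /ampl_val /idT.
under eq_bigr do rewrite pair_bigA mulr_sumr /=.
rewrite pair_bigA /=.
pose h (t : ((('I_dA * 'I_dRA) * 'I_n) * (('I_dA * 'I_dRA) * 'I_n)) *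
            ((('I_dB * 'I_dRB) * 'I_n') * (('I_dB * 'I_dRB) * 'I_n'))) :=
  ((((t.1.1.1.1, t.1.1.2), (t.1.2.1.1, t.1.2.2)),
    ((t.2.1.1.1, t.2.1.2), (t.2.2.1.1, t.2.2.2))),
   ((t.1.1.1.2, t.2.1.1.2), (t.1.2.1.2, t.2.2.1.2))).
rewrite (reindex h) /=.
  by apply: eq_bigr => -[[[[x s] i] [[x' s'] i']] [[[y r] j] [[y' r'] j']]] _ /=; rewrite /mxtens /=; ring.
apply: onW_bij.
exists (fun u => ((((u.1.1.1.1, u.2.1.1), u.1.1.1.2), ((u.1.1.2.1, u.2.2.1), u.1.1.2.2)),
                  (((u.1.2.1.1, u.2.1.2), u.1.2.1.2), ((u.1.2.2.1, u.2.2.2), u.1.2.2.2)))).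
  by move=> [[[[x s] i] [[x' s'] i']] [[[y r] j] [[y' r'] j']]].
by move=> [[[[? ?] [? ?]] [[? ?] [? ?]]] [[? ?] [? ?]]].
Qed.

Lemma orthofamily_entries (d m : nat) (V : 'I_m -> mx R 'I_d 'I_d) :
  (forall j k, mtrace (mxmul (adj (V j)) (V k)) = (#|'I_d| * (j == k))%:R) ->
  orthofamily (fun j (p : 'I_d * 'I_d) => V j p.1 p.2) d%:R.
Proof.
move=> hV j k; have := hV j k; rewrite card_ord natrM => <-.
by rewrite sum_pair exchange_big.
Qed.

(** With D = d_A d_B, orthogonality gives <V_j (x) W_j, U> = D c_j. Hence <Phi, vec U> = D sum_j
    c_j, while sum_j c_j^2 = 1 gives |vec U|^2 = D. *)
Lemma schmidt_witness_value (dA dB m : nat) (U : mx R ('I_dA * 'I_dB) ('I_dA * 'I_dB))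
    (c : 'I_m -> R) (V : 'I_m -> mx R 'I_dA 'I_dA) (W : 'I_m -> mx R 'I_dB 'I_dB) :
  is_op_schmidt U c V W ->
  ampl_val (iso_conj U)
    (schmidt_witness (fun j p => V j p.1 p.2) (fun j p => W j p.1 p.2) (dA%:R * dB%:R))
    (@maxent 'I_dA) (@maxent 'I_dB) =
  (dA%:R * dB%:R) ^+ 2 * (2 * (\sum_j c j) ^+ 2 - 1)%:C%C.
Proof.
move=> [eU /orthofamily_entries hV /orthofamily_entries hW _ c1].
set f := (fun j _ => _) in hV *; set g := (fun j _ => _) in hW *.
rewrite ampl_val_iso_conj_maxent.
rewrite (schmidt_witness_pure f g _ (fun p q => U (p.1, q.1) (p.2, q.2))).
have UE p q : U (p.1, q.1) (p.2, q.2) = \sum_j (c j)%:C%C * (f j p * g j q) by rewrite eU.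
have orth j k : \sum_s (f j s.1 * g j s.2)^* * (f k s.1 * g k s.2) =
    dA%:R * dB%:R * (j == k)%:R.
  rewrite sum_pair /=.
  transitivity ((\sum_x (f j x)^* * f k x) * (\sum_y (g j y)^* * g k y)).
    rewrite mulr_suml; apply: eq_bigr => x _; rewrite mulr_sumr.
    by apply: eq_bigr => y _; rewrite rmorphM /=; ring.
  by rewrite hV hW; case: (j == k) => /=; ring.
have fU j : \sum_s (f j s.1 * g j s.2)^* * U (s.1.1, s.2.1) (s.1.2, s.2.2) =
    dA%:R * dB%:R * (c j)%:C%C.
  under eq_bigr do rewrite UE mulr_sumr.
  rewrite exchange_big (bigD1 j) //= [X in _ + X]big1 ?addr0 => [|k kj].
    transitivity ((c j)%:C%C * \sum_s (f j s.1 * g j s.2)^* * (f j s.1 * g j s.2)).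
      by rewrite mulr_sumr; apply: eq_bigr => s _; ring.
    by rewrite orth eqxx /=; ring.
  transitivity ((c k)%:C%C * \sum_s (f j s.1 * g j s.2)^* * (f k s.1 * g k s.2)).
    by rewrite mulr_sumr; apply: eq_bigr => s _; ring.
  by rewrite orth eq_sym (negPf kj) /=; ring.
have cJ j : ((c j)%:C%C)^* = (c j)%:C%C :> C.
  by rewrite conj_Creal ?real_complex_is_real.
have -> : vnorm2 (fun s => U (s.1.1, s.2.1) (s.1.2, s.2.2)) = dA%:R * dB%:R.
  transitivity (\sum_s \sum_j (c j)%:C%C * ((f j s.1 * g j s.2)^* * U (s.1.1, s.2.1) (s.1.2, s.2.2))).
    apply: eq_bigr => s _; rewrite normCKC {1}UE rmorph_sum mulr_suml.
    by apply: eq_bigr => j _; rewrite rmorphM /= cJ; ring.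
  rewrite exchange_big /=; under eq_bigr do rewrite -mulr_sumr fU.
  transitivity (dA%:R * dB%:R * (\sum_j c j ^+ 2)%:C%C : C); last by rewrite c1 mulr1.
  by rewrite rmorph_sum mulr_sumr; apply: eq_bigr => j _; rewrite rmorphXn /=; ring.
have -> : \sum_s (schmidt_vec f g s.1 s.2)^* * U (s.1.1, s.2.1) (s.1.2, s.2.2) =
    dA%:R * dB%:R * (\sum_j c j)%:C%C.
  rewrite rmorph_sum mulr_sumr; under [RHS]eq_bigr do rewrite -fU.
  rewrite [RHS]exchange_big; apply: eq_bigr => s _ /=.
  by rewrite rmorph_sum mulr_suml.
rewrite real_normK; last first.
  by rewrite !realM ?realn ?real_complex_is_real.
rewrite rmorphB rmorphM rmorphXn /= rmorph1 rmorph_nat; ring.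
Qed.

Lemma space_like_cut_bound (dA dB m dRA dRB : nat) (I : finType)
    (U : mx R ('I_dA * 'I_dB) ('I_dA * 'I_dB))
    (c : 'I_m -> R) (V : 'I_m -> mx R 'I_dA 'I_dA) (W : 'I_m -> mx R 'I_dB 'I_dB)
    (a : I -> R) (E : I -> sop R ('I_dA * 'I_dB) (('I_dA * 'I_dRA) * ('I_dB * 'I_dRB)))
    (OA : I -> mx R 'I_dRA 'I_dRA) (OB : I -> mx R 'I_dRB 'I_dRB) :
  (0 < dA)%N -> (0 < dB)%N -> is_op_schmidt U c V W ->
  is_space_like_cut a E OA OB (iso_conj U) ->
  2 * (\sum_j c j) ^+ 2 - 1 <= norm1 a.
Proof.
move=> dA0 dB0 schmU [eU locE hO].
set D : C := dA%:R * dB%:R.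
have D0 : 0 < D by rewrite mulr_gt0 // ltr0n.
have [_ /orthofamily_entries hV /orthofamily_entries hW _ _] := schmU.
pose w := schmidt_witness (fun j (p : 'I_dA * 'I_dA) => V j p.1 p.2)
  (fun j (p : 'I_dB * 'I_dB) => W j p.1 p.2) D.
have hw P Q : psd P -> psd Q -> `|bilin_val w P Q| <= D * (mtrace P * mtrace Q).
  by apply: schmidt_witness_bound; rewrite ?ltr0n.
pose v i := ampl_val (fun rho => idT (mxtens (OA i) (OB i)) (E i rho)) w
  (@maxent 'I_dA) (@maxent 'I_dB).
have v_le i : `|v i| <= D ^+ 2.
  (* One factor [D] comes from the witness bound, the other from the traces of the two unnormalised
     inputs. *)
  have -> : D ^+ 2 = D * (mtrace (@maxent 'I_dA) * mtrace (@maxent 'I_dB)).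
    by rewrite !mtrace_maxent !card_ord expr2.
  rewrite /v ampl_val_idT; apply: LOCC_bound => // [P Q pP pQ||]; try exact: psd_maxent.
  apply: (product_observable_bound (p := fun z => (z.1.1, z.2)) (q := fun z => z.1.2)
    (p' := fun z => (z.1.1, z.2)) (q' := fun z => z.1.2) _ _ (hO i) (ltW D0) hw pP pQ).
    by move=> [[? ?] ?] [[? ?] ?] /= [-> -> ->].
  by move=> [[? ?] ?] [[? ?] ?] /= [-> -> ->].
have := schmidt_witness_value schmU; rewrite -/D -/w.
have -> : ampl_val (iso_conj U) w (@maxent 'I_dA) (@maxent 'I_dB) = \sum_i (a i)%:C%C * v i.
  under [RHS]eq_bigr do rewrite mulr_sumr.
  rewrite exchange_big; apply: eq_bigr => t _ /=.
  by rewrite eU mulr_sumr; apply: eq_bigr => i _; ring.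
move=> e.
rewrite -lecR -(ler_pM2l (exprn_gt0 2 D0)) -e.
(* Single terms [v i] may be complex when the observables are not Hermitian; the whole sum is real
   because it equals the witness value. *)
apply: le_trans (real_ler_norm _) _.
  by rewrite e realM ?real_complex_is_real // realX // gtr0_real.
apply: le_trans (ler_norm_sum _ _ _) _.
rewrite /norm1 rmorph_sum mulr_sumr; apply: ler_sum => i _.
rewrite normrM mulrC; apply: ler_pM => //.
by rewrite normc_def /= expr0n addr0 sqrtr_sqr.
Qed.
End LowerBound.

(** * The double Hadamard test as a local cut *)

Section DoubleHadamard.
Variable R : realType.
Local Notation C := R[i].

Lemma mxmul_onanc (A Y : finType) (G : mx R 'I_2 'I_2) (M : mx R (A * 'I_2) Y) p y :
  mxmul (onanc G) M p y = \sum_s G p.2 s * M (p.1, s) y.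
Proof.
rewrite /mxmul sum_pair /=.
rewrite (bigD1 p.1) //= [X in _ + X]big1 ?addr0 => [|a ap].
  by apply: eq_bigr => s _; rewrite /onanc /mxtens /idmx /= eqxx mul1r.
by rewrite big1 // => s _; rewrite /onanc /mxtens /idmx /= eq_sym (negPf ap) !mul0r.
Qed.

Lemma mxmul_ctrlU (A Y : finType) (V0 V1 : mx R A A) (M : mx R (A * 'I_2) Y) p y :
  mxmul (ctrlU V0 V1) M p y =
  \sum_a (if qb0 p.2 then V0 else V1) p.1 a * M (a, p.2) y.
Proof.
rewrite /mxmul sum_pair /=.
apply: eq_bigr => a _; rewrite (bigD1 p.2) //= [X in _ + X]big1 ?addr0 => [|s sp].
  by rewrite /ctrlU /= eqxx; case: qb0.
by rewrite /ctrlU /= eq_sym (negPf sp) mul0r.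
Qed.

Definition phase (g : bool) : C := if g then 'i else 1.

Lemma phaseJ g : phase g * (phase g)^* = 1.
Proof. by case: g; rewrite /phase ?conjC1 ?mulr1 // conjCi mulrN -expr2 sqrCi opprK. Qed.

Lemma hadamard_scale : ((Num.sqrt (2%:R : R))^-1)%:C%C * ((Num.sqrt (2%:R : R))^-1)%:C%C = 2^-1 :> C.
Proof.
rewrite -rmorphM -invfM -expr2 sqr_sqrtr ?ler0n //.
by rewrite fmorphV rmorph_nat.
Qed.

Lemma dh_isoE (A : finType) (V0 V1 : mx R A A) g p y :
  dh_iso V0 V1 g p y =
  2^-1 * (V0 p.1 y + (if qb0 p.2 then 1 else -1) * phase g * V1 p.1 y).
Proof.
have row (V : mx R A A) (h : A -> C) :
    \sum_a V p.1 a * (h a * (a == y)%:R) = V p.1 y * h y.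
  rewrite (bigD1 y) //= eqxx mulr1 big1 ?addr0 // => a /negPf ->.
  by rewrite !mulr0.
rewrite /dh_iso mxmul_onanc.
under eq_bigr do rewrite mxmul_ctrlU /=.
(* The ancilla before the controlled unitary: amplitude 1/sqrt(2) on |0> and [phase g] / sqrt(2) on
   |1>. *)
have inner a (s : 'I_2) :
  mxmul (onanc (if g then phaseS R else idmx R 'I_2))
     (mxmul (onanc (hadamard R)) (append0 R A)) (a, s) y =
  ((if qb0 s then 1 else phase g) * ((Num.sqrt (2%:R : R))^-1)%:C%C) * (a == y)%:R.
  rewrite mxmul_onanc /= !big_ord_recl big_ord0 /= !mxmul_onanc !big_ord_recl !big_ord0 /=.
  rewrite /append0 /hadamard /phaseS /idmx /phase /qb0 /=.
  rewrite !eqxx -![bump 0 0 == 0%N]/false !andbT !andbF.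
  by case: g; case: s => [[|[|s]] hs] //=; rewrite ?complexiE; ring.
under eq_bigr do under eq_bigr do rewrite inner.
under eq_bigr do rewrite (row _ (fun=> _)).
rewrite !big_ord_recl big_ord0 /= /hadamard /= !andbT /qb0 /= -hadamard_scale.
by case: p.2 => [[|[|s]] hs] //=; ring.
Qed.

(** The cross terms between [a] and [b] carry opposite signs at the two ancilla values and cancel,
    so the isometry property reduces to that of the two branches. *)
Lemma sum_conj_anc (A : finType) (a b a' b' : A -> C) g :
  \sum_(p : A * 'I_2)
    (2^-1 * (a p.1 + (if qb0 p.2 then 1 else -1) * phase g * b p.1))^* *
    (2^-1 * (a' p.1 + (if qb0 p.2 then 1 else -1) * phase g * b' p.1)) =
  2^-1 * (\sum_x (a x)^* * a' x + \sum_x (b x)^* * b' x).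
Proof.
rewrite sum_pair /=.
rewrite -big_split mulr_sumr; apply: eq_bigr => x _ /=.
rewrite !big_ord_recl big_ord0 /= !rmorphM !rmorphD !rmorphM !rmorphV ?unitfE ?pnatr_eq0 //=.
rewrite rmorphN rmorph_nat conjC1.
transitivity (2^-1 * ((2^-1 + 2^-1) * ((a x)^* * a' x + (phase g * (phase g)^*) * ((b x)^* * b' x)))).
  by ring.
by rewrite phaseJ mul1r; congr (_ * _); field.
Qed.

Lemma dh_iso_isometry (A : finType) (V0 V1 : mx R A A) g :
  unitary V0 -> unitary V1 -> isometry (dh_iso V0 V1 g).
Proof.
move=> [u0 _] [u1 _]; apply/funext => x; apply/funext => y.
rewrite /mxmul /adj; under eq_bigr do rewrite !dh_isoE.
rewrite (sum_conj_anc (V0^~ x) (V1^~ x) (V0^~ y) (V1^~ y)).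
have := congr1 (fun M => M x y) u0; have := congr1 (fun M => M x y) u1.
rewrite /mxmul /adj => -> ->.
by rewrite /idmx; field.
Qed.

Lemma iso_conjE (X Y : finType) (K : mx R Y X) rho x y :
  iso_conj K rho x y = \sum_a \sum_b rho a b * (K x a * (K y b)^*).
Proof.
rewrite /iso_conj /mxmul exchange_big; apply: eq_bigr => b _ /=.
by rewrite mulr_suml; apply: eq_bigr => a _; rewrite /adj; ring.
Qed.

Lemma rank1_psd (X K : finType) (P : mx R X X) (u : K -> X -> C) :
  (forall x y, P x y = \sum_k u k x * (u k y)^*) -> psd P.
Proof.
move=> hP v.
suff -> : \sum_x \sum_y (v x)^* * P x y * v y = \sum_k `|\sum_x (v x)^* * u k x| ^+ 2.
  by apply: sumr_ge0 => k _; rewrite exprn_ge0.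
under eq_bigr do under eq_bigr do rewrite hP mulr_sumr mulr_suml.
under eq_bigr do rewrite exchange_big /=.
rewrite exchange_big; apply: eq_bigr => k _ /=.
rewrite normCK rmorph_sum mulr_suml; apply: eq_bigr => x _.
by rewrite mulr_sumr; apply: eq_bigr => y _; rewrite rmorphM /= conjCK; ring.
Qed.

Lemma isometry_channel (X Y : finType) (K : mx R Y X) : isometry K -> channel (iso_conj K).
Proof.
move=> hK; split.
  split.
    move=> a rho sigma; apply/funext => x; apply/funext => y.
    rewrite !iso_conjE mulr_sumr -big_split; apply: eq_bigr => z _ /=.
    by rewrite mulr_sumr -big_split; apply: eq_bigr => w _ /=; ring.
  move=> n P /psd_rank1 [u hP].
  apply: (@rank1_psd _ _ _ (fun k p => \sum_a K p.1 a * u k (a, p.2))) => x y.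
  rewrite /ampl iso_conjE.
  under eq_bigr do under eq_bigr do rewrite hP mulr_suml.
  under eq_bigr do rewrite exchange_big /=.
  rewrite exchange_big; apply: eq_bigr => k _ /=.
  rewrite rmorph_sum mulr_suml; apply: eq_bigr => a _; rewrite mulr_sumr.
  by apply: eq_bigr => b _; rewrite rmorphM /=; ring.
move=> rho; rewrite /mtrace.
transitivity (\sum_w \sum_z rho w z * \sum_x (K x z)^* * K x w).
  under eq_bigr do rewrite iso_conjE.
  rewrite exchange_big; apply: eq_bigr => w _ /=; rewrite exchange_big.
  by apply: eq_bigr => z _ /=; rewrite mulr_sumr; apply: eq_bigr => x _; ring.
apply: eq_bigr => w _; rewrite (bigD1 w) //= [X in _ + X]big1 ?addr0 => [|z zw].
  by have := congr1 (fun M => M w w) hK; rewrite /mxmul /adj /idmx eqxx => ->; rewrite mulr1.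
by have := congr1 (fun M => M z w) hK; rewrite /mxmul /adj /idmx (negPf zw) => ->; rewrite mulr0.
Qed.

Lemma iso_conj_ematrix (X Y : finType) (K : mx R Y X) a b x y :
  iso_conj K (ematrix R a b) x y = K x a * (K y b)^*.
Proof.
rewrite iso_conjE (bigD1 a) //= [X in _ + X]big1 ?addr0 => [|a' a'a].
  rewrite (bigD1 b) //= [X in _ + X]big1 ?addr0 => [|b' b'b]; rewrite /ematrix.
    by rewrite !eqxx mul1r.
  by rewrite (negPf b'b) andbF mul0r.
by rewrite big1 // => b' _; rewrite /ematrix (negPf a'a) mul0r.
Qed.

(* Matrix entries of rho |-> Tr_R (sigma_z K rho K') for K = [dh_iso V0 V1 g]. *)
Definition dh_kernel (A : finType) (V0 V1 : mx R A A) g x a x' b : C :=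
  2^-1 * ((phase g)^* * (V0 x a * (V1 x' b)^*) + phase g * (V1 x a * (V0 x' b)^*)).

(** The sign of sigma_z has the opposite effect to a plain trace: the terms with the same unitary on
    both sides cancel and the cross terms survive. *)
Lemma dh_kernelE (A : finType) (V0 V1 : mx R A A) g x a x' b :
  \sum_s \sum_s' dh_iso V0 V1 g (x, s) a * (dh_iso V0 V1 g (x', s') b)^* * sigmaz R s' s =
  dh_kernel V0 V1 g x a x' b.
Proof.
rewrite !big_ord_recl !big_ord0 !dh_isoE /sigmaz /dh_kernel /=.
rewrite !rmorphM !rmorphD !rmorphM !rmorphV ?unitfE ?pnatr_eq0 //=.
rewrite rmorphN rmorph_nat conjC1.
by field.
Qed.

Lemma idT_dhE (A B : finType) (V0 V1 : mx R A A) (W0 W1 : mx R B B) g rho x x' :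
  idT (mxtens (sigmaz R) (sigmaz R))
    (stens (iso_conj (dh_iso V0 V1 g)) (iso_conj (dh_iso W0 W1 g)) rho) x x' =
  \sum_a \sum_b rho a b * (dh_kernel V0 V1 g x.1 a.1 x'.1 b.1 *
                           dh_kernel W0 W1 g x.2 a.2 x'.2 b.2).
Proof.
rewrite /idT /stens [LHS]pair_bigA [RHS]pair_bigA /=.
under [LHS]eq_bigr do rewrite pair_bigA mulr_suml /=.
rewrite exchange_big; apply: eq_bigr => -[a b] _ /=.
rewrite -!dh_kernelE; rewrite [\sum_s \sum_s' dh_iso V0 _ _ _ _ * _ * _]pair_bigA /=.
rewrite [\sum_s \sum_s' dh_iso W0 _ _ _ _ * _ * _]pair_bigA /=.
rewrite mulr_suml mulr_sumr.
transitivity (\sum_t \sum_s rho a b * ((dh_iso V0 V1 g (x.1, t.1) a.1 * (dh_iso V0 V1 g (x'.1, t.2) b.1)^* * sigmaz R t.2 t.1) *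
   (dh_iso W0 W1 g (x.2, s.1) a.2 * (dh_iso W0 W1 g (x'.2, s.2) b.2)^* * sigmaz R s.2 s.1))); last first.
  by apply: eq_bigr => t _; rewrite !mulr_sumr.
rewrite pair_bigA /=.
(* The four ancilla indices are regrouped by party instead of by row and column, so that the sum
   factorises. *)
rewrite (reindex (fun u : ('I_2 * 'I_2) * ('I_2 * 'I_2) => ((u.1.1, u.2.1), (u.1.2, u.2.2)))) /=.
  by apply: eq_bigr => u _; rewrite !iso_conj_ematrix /mxtens /=; ring.
apply: onW_bij; exists (fun u => ((u.1.1, u.2.1), (u.1.2, u.2.2))).
  by move=> [[? ?] [? ?]].
by move=> [[? ?] [? ?]].
Qed.

Lemma double_hadamard (A B : finType) m (U : mx R (A * B) (A * B)) (c : 'I_m -> R)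
    (V : 'I_m -> mx R A A) (W : 'I_m -> mx R B B) rho x x' :
  is_prod_decomp U c V W ->
  let T := mxtens (sigmaz R) (sigmaz R) in
  iso_conj U rho x x' =
    \sum_(i < m) \sum_(j < m) (c i * c j)%:C%C *
      idT T (stens (dh_channel V i j false) (dh_channel W i j false) rho) x x'
  - \sum_(i < m) \sum_(j < m | j != i) (c i * c j)%:C%C *
      idT T (stens (dh_channel V i j true) (dh_channel W i j true) rho) x x'.
Proof.
move=> eU T.
(* For i = j the phases i and -i cancel in the kernel, so the diagonal excluded from the second sum
   can be added back. *)
have diag i : idT T (stens (dh_channel V i i true) (dh_channel W i i true) rho) x x' = 0.
  rewrite idT_dhE big1 // => a _; rewrite big1 // => b _.
  rewrite {1}/dh_kernel /phase conjCi; ring.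
under [X in _ - X]eq_bigr => i _.
  have -> : \sum_(j < m | j != i) (c i * c j)%:C%C *
      idT T (stens (dh_channel V i j true) (dh_channel W i j true) rho) x x' =
    \sum_(j < m) (c i * c j)%:C%C *
      idT T (stens (dh_channel V i j true) (dh_channel W i j true) rho) x x'.
    by rewrite [RHS](bigD1 i) //= diag mulr0 add0r.
  over.
rewrite -sumrB; under [RHS]eq_bigr do rewrite -sumrB.
pose G j (x a : A * B) := mxtens (V j) (W j) x a.
pose H i j := \sum_a \sum_b rho a b * (G i x a * (G j x' b)^*).
have cJ j : ((c j)%:C%C)^* = (c j)%:C%C :> C by rewrite conj_Creal ?real_complex_is_real.
have UH : iso_conj U rho x x' = \sum_i \sum_j (c i * c j)%:C%C * H i j.
  rewrite iso_conjE eU.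
  transitivity (\sum_a \sum_b \sum_i \sum_j (c i * c j)%:C%C * (rho a b * (G i x a * (G j x' b)^*))).
    apply: eq_bigr => a _; apply: eq_bigr => b _.
    rewrite rmorph_sum mulr_suml mulr_sumr; apply: eq_bigr => i _.
    rewrite !mulr_sumr; apply: eq_bigr => j _.
    by rewrite !rmorphM /= cJ /G; ring.
  under eq_bigr do rewrite exchange_big /=.
  rewrite exchange_big; apply: eq_bigr => i _ /=.
  under eq_bigr do rewrite exchange_big /=.
  rewrite exchange_big; apply: eq_bigr => j _ /=.
  by rewrite /H mulr_sumr; apply: eq_bigr => a _; rewrite mulr_sumr.
(* The two tests for (i, j) yield the mean of the (i, j) and (j, i) terms. The weights c_i c_j are
   symmetric, so the total is unchanged. *)
transitivity (\sum_i \sum_j (c i * c j)%:C%C * (2^-1 * (H i j + H j i))).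
  transitivity (2^-1 * (\sum_i \sum_j (c i * c j)%:C%C * H i j) +
                2^-1 * (\sum_i \sum_j (c i * c j)%:C%C * H j i)).
    rewrite [X in _ + 2^-1 * X]exchange_big /= UH.
    under [X in _ + 2^-1 * X]eq_bigr do under eq_bigr do rewrite mulrC [c _ * c _]mulrC mulrC.
    by field.
  rewrite !mulr_sumr -big_split; apply: eq_bigr => i _ /=.
  by rewrite !mulr_sumr -big_split; apply: eq_bigr => j _ /=; ring.
apply: eq_bigr => i _; apply: eq_bigr => j _.
rewrite -mulrBr !idT_dhE -sumrB; congr (_ * _).
rewrite /H -big_split mulr_sumr; apply: eq_bigr => a _ /=.
rewrite -big_split -sumrB mulr_sumr; apply: eq_bigr => b _ /=.
rewrite /dh_kernel /phase /G /mxtens !rmorphM /= conjC1 conjCi.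
have ii : 'i * 'i = -1 :> C by rewrite -expr2 sqrCi.
set p := V i x.1 a.1; set q := V j x.1 a.1; set p' := W i x.2 a.2; set q' := W j x.2 a.2.
set r := (V i _ _)^*; set s := (V j _ _)^*; set r' := (W i _ _)^*; set s' := (W j _ _)^*.
(* The products p s q' r' and q r p' s' cancel between g = 0 and g = 1, while p s p' s' and q r q'
   r' double. The square of the imaginary unit is kept explicit until [ii] evaluates it. *)
transitivity (rho a b * (2^-1 * 2^-1) * ((p * s + q * r) * (p' * s' + q' * r')
   - 'i * 'i * ((q * r - p * s) * (q' * r' - p' * s')))); last by ring.
by rewrite ii; field.
Qed.

Lemma big_DHidx (Z : nmodType) m (F : 'I_m * 'I_m * bool -> Z) :
  \sum_(x : DHidx m) F (val x) = \sum_i \sum_j F (i, j, false) + \sum_i \sum_(j | j != i) F (i, j, true).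
Proof.
rewrite -(big_sub [pred x : 'I_m * 'I_m * bool | x.2 ==> (x.1.1 != x.1.2)]).
rewrite big_mkcond sum_pair /= sum_pair -big_split; apply: eq_bigr => i _ /=.
rewrite [X in _ = _ + X]big_mkcond -big_split; apply: eq_bigr => j _ /=.
by rewrite big_bool /= !inE /= addrC eq_sym.
Qed.

(** The tests with g = 0 contribute |c|_1^2, and those with g = 1, which omit the diagonal,
    contribute |c|_1^2 - |c|_2^2. *)
Lemma norm1_dh_coef m (c : 'I_m -> R) :
  norm1 (dh_coef c) = 2 * norm1 c ^+ 2 - \sum_j c j ^+ 2.
Proof.
rewrite /norm1 (big_DHidx (fun x => `|if x.2 then - (c x.1.1 * c x.1.2) else c x.1.1 * c x.1.2|)) /=.
have sq : (\sum_i `|c i|) ^+ 2 = \sum_i \sum_j `|c i * c j|.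
  rewrite expr2 mulr_suml; apply: eq_bigr => i _; rewrite mulr_sumr.
  by apply: eq_bigr => j _; rewrite normrM.
rewrite mulr_natl mulr2n sq -addrA; congr (_ + _); rewrite -sumrB; apply: eq_bigr => i _.
rewrite [X in _ = X - _](bigD1 i) //= normrM -expr2 real_normK ?num_real // addrAC subrr add0r.
by apply: eq_bigr => j _; rewrite normrN.
Qed.

Lemma opnorm_sigmaz : opnorm_le1 (mxtens (sigmaz R) (sigmaz R)).
Proof.
move=> v; apply: ler_sum => -[s t] _.
have -> : mxapp (mxtens (sigmaz R) (sigmaz R)) v (s, t) = sigmaz R s s * sigmaz R t t * v (s, t).
  rewrite /mxapp (bigD1 (s, t)) //= [X in _ + X]big1 ?addr0 // => -[s' t'].
  rewrite xpair_eqE negb_and /mxtens /sigmaz /= (eq_sym s) (eq_sym t).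
  by case/orP => /negPf ->; rewrite !(mul0r, mulr0).
rewrite !normrM /sigmaz !eqxx.
by case: (qb0 s); case: (qb0 t); rewrite ?normrN !normr1 !mul1r.
Qed.

Lemma double_hadamard_local_cut (A B : finType) m (U : mx R (A * B) (A * B)) (c : 'I_m -> R)
    (V : 'I_m -> mx R A A) (W : 'I_m -> mx R B B) :
  (forall j, unitary (V j)) -> (forall j, unitary (W j)) -> is_prod_decomp U c V W ->
  is_local_cut (dh_coef c) (dh_E V W) (fun=> sigmaz R) (fun=> sigmaz R) (iso_conj U).
Proof.
move=> uV uW eU; split; first split.
- move=> rho; apply/funext => x; apply/funext => x'.
  rewrite (double_hadamard rho x x' eU) /dh_coef /dh_E.
  rewrite (big_DHidx (fun t => (if t.2 then - (c t.1.1 * c t.1.2) else c t.1.1 * c t.1.2)%:C%C *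
    idT (mxtens (sigmaz R) (sigmaz R))
      (stens (dh_channel V t.1.1 t.1.2 t.2) (dh_channel W t.1.1 t.1.2 t.2) rho) x x')) /=.
  congr (_ + _); rewrite -sumrN; apply: eq_bigr => i _; rewrite -sumrN.
  by apply: eq_bigr => j _; rewrite rmorphN mulNr.
- by move=> t; apply: LOCC_local; apply/isometry_channel/dh_iso_isometry.
- by move=> _; apply: opnorm_sigmaz.
move=> t; exists (dh_channel V (val t).1.1 (val t).1.2 (val t).2).
exists (dh_channel W (val t).1.1 (val t).1.2 (val t).2).
by split=> //; eexists; split; [apply: dh_iso_isometry | reflexivity
                               | apply: dh_iso_isometry | reflexivity].
Qed.

(** [gamma] ranges over cuts indexed by ordinals; this relabelling admits the cut indexed by
    [DHidx]. *)
Lemma space_like_cut_enum (A B I : finType) (dRA dRB : nat) (a : I -> R)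
    (E : I -> sop R (A * B) ((A * 'I_dRA) * (B * 'I_dRB)))
    (OA : I -> mx R 'I_dRA 'I_dRA) (OB : I -> mx R 'I_dRB 'I_dRB)
    (N : sop R (A * B) (A * B)) :
  is_space_like_cut a E OA OB N ->
  is_space_like_cut (a \o @enum_val I predT) (E \o @enum_val I predT)
    (OA \o @enum_val I predT) (OB \o @enum_val I predT) N.
Proof.
move=> [eN lE hO]; split=> [rho|i|i] /=; [|exact: lE|exact: hO].
rewrite eN; apply/funext => x; apply/funext => x'.
by rewrite (reindex _ (onW_bij _ (enum_val_bij I))).
Qed.

Lemma norm1_enum (I : finType) (a : I -> R) : norm1 (a \o @enum_val I predT) = norm1 a.
Proof. by rewrite /norm1 [RHS](reindex _ (onW_bij _ (enum_val_bij I))). Qed.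

Lemma inf_minimum (S : R -> Prop) (x : R) : S x -> (forall y, S y -> x <= y) -> inf S = x.
Proof.
move=> Sx lbx; apply/le_anti/andP; split.
  by apply: ge_inf => //; exists x.
by apply: lb_le_inf => //; exists x.
Qed.

End DoubleHadamard.

(** * Both infima as attained minima *)

Local Open Scope complex_scope.

Theorem theorem1 (R : realType) (dA dB : nat) (HdA : (0 < dA)%N) (HdB : (0 < dB)%N)
  (U : mx R ('I_dA * 'I_dB) ('I_dA * 'I_dB)) (HU : unitary U)
  (m : nat) (c : 'I_m -> R) (V : 'I_m -> mx R 'I_dA 'I_dA) (W : 'I_m -> mx R 'I_dB 'I_dB)
  (HV : forall j, unitary (V j)) (HW : forall j, unitary (W j))
  (Hdec : is_prod_decomp U c V W) :
  let phi := 2 * norm1 c ^+ 2 - \sum_j c j ^+ 2 in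
  let Uch := iso_conj U in
  let T := mxtens (sigmaz R) (sigmaz R) in
  [/\ (* the double Hadamard decomposition of the channel U *)
      forall rho, Uch rho =
        (fun x x' =>
           \sum_(i < m) \sum_(j < m) (c i * c j)%:C *
               idT T (stens (dh_channel V i j false) (dh_channel W i j false) rho) x x'
         - \sum_(i < m) \sum_(j < m | j != i) (c i * c j)%:C *
               idT T (stens (dh_channel V i j true) (dh_channel W i j true) rho) x x'),
      (* it is a local space-like cut with two ancilla qubits ... *)
      @is_local_cut R _ _ (DHidx m) 2 2 (dh_coef c) (dh_E V W)
        (fun _ => sigmaz R) (fun _ => sigmaz R) Uch,
      (* ... of 1-norm phi *)
      norm1 (dh_coef c) = phi &
      (* optimality for operator Schmidt decompositions *)
      is_op_schmidt U c V W ->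
        [/\ phi = product_extent U, product_extent U = gamma Uch &
            gamma Uch = 2 * norm1 c ^+ 2 - 1]].
Proof.
move=> phi Uch T; split.
- by move=> rho; apply/funext => x; apply/funext => x'; apply: double_hadamard.
- exact: double_hadamard_local_cut.
- exact: norm1_dh_coef.
move=> schmU; have [_ _ _ c_gt0 c1] := schmU.
have nc : norm1 c = \sum_j c j.
  by apply: eq_bigr => j _; rewrite gtr0_norm.
have phiE : phi = 2 * norm1 c ^+ 2 - 1 by rewrite /phi c1.
(* Every product decomposition yields a cut of equal value, so the lower bound for cuts settles both
   [gamma] and the product extent. *)
have cut_of_decomp k (c' : 'I_k -> R) V' W' :
    (forall j, unitary (V' j)) -> (forall j, unitary (W' j)) -> is_prod_decomp U c' V' W' ->
    exists (n dRA dRB : nat) (a : 'I_n -> R)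
      (E : 'I_n -> sop R ('I_dA * 'I_dB) (('I_dA * 'I_dRA) * ('I_dB * 'I_dRB)))
      (OA : 'I_n -> mx R 'I_dRA 'I_dRA) (OB : 'I_n -> mx R 'I_dRB 'I_dRB),
      is_space_like_cut a E OA OB Uch /\ 2 * norm1 c' ^+ 2 - \sum_j c' j ^+ 2 = norm1 a.
  move=> uV uW eU; have [cut _] := double_hadamard_local_cut uV uW eU.
  do 7!eexists; split; first exact: space_like_cut_enum cut.
  by rewrite norm1_enum norm1_dh_coef.
have gammaE : gamma Uch = phi.
  apply: inf_minimum; first exact: cut_of_decomp HV HW Hdec.
  move=> _ [n [dRA [dRB [a [E [OA [OB [cut ->]]]]]]]].
  by rewrite phiE nc; apply: space_like_cut_bound schmU cut.
have extentE : product_extent U = phi.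
  apply: inf_minimum; first by exists m, c, V, W.
  move=> _ [k [c' [V' [W' [uV uW eU ->]]]]].
  have [n [dRA [dRB [a [E [OA [OB [cut ->]]]]]]]] := cut_of_decomp _ _ _ _ uV uW eU.
  by rewrite phiE nc; apply: space_like_cut_bound schmU cut.
by rewrite gammaE extentE phiE.
Qed.
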